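(* Let $D\Subset\mathbb C^2$ be a bounded domain with smooth strictly pseudoconvex boundary, and let $\Phi:\mathbb D^2\to\Omega\subset\mathbb C^2$ be a biholomorphic embedding extending holomorphically to a neighborhood of $\overline{\mathbb D}^2$, with $\Phi(0)=0$, such that $$\Phi(\overline{\mathbb D}^2)\subset\overline D,\qquad T:=\Phi(\mathbb T^2)\subset\partial D .$$ Let $\mathcal F$ be a one-dimensional holomorphic foliation defined in a neighborhood of $\Phi(\overline{\mathbb D}^2)$ and assume $$T\subset M(\mathcal F,\partial D).$$ Suppose that the pulled-back foliation $\mathcal G=\Phi^*\mathcal F$ is defined on a neighborhood of $\overline{\mathbb D}^2$ by $$\omega=a(z,w)\frac{dz}{z}+b(z,w)\frac{dw}{w},$$ where $a$ and $b$ are holomorphic units. Then the germ of $\mathcal F$ at $0$ is analytically linearizable of Siegel type.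
   Context: $\mathbb D\subset\mathbb C$ is the open unit disc, $\mathbb T^2=\{(z,w):|z|=|w|=1\}$, and $\Omega$ is the image $\Phi(\mathbb D^2)$. ''Holomorphic units'' means holomorphic nowhere-vanishing functions on the given neighborhood of $\overline{\mathbb D}^2$; that $\omega$ defines $\mathcal G$ means that $\mathcal G$ is the foliation given by the holomorphic form $zw\,\omega=a\,w\,dz+b\,z\,dw=0$. The germ of $\mathcal F$ at $0$ is analytically linearizable of Siegel type if there is a local biholomorphism $\Psi:(\mathbb C^2,0)\to(\mathbb C^2,0)$ with $\Psi_*\mathcal F$ given by $z\,dw-\tau w\,dz=0$, $\tau\in\mathbb R_{<0}$. For a smooth real hypersurface $H\subset\mathbb C^2$ and a point $p\in H$ at which $\mathcal F$ is regular, $\mathcal F$ is complex tangent to $H$ at $p$ if the tangent line of $\mathcal F$ at $p$ is contained in the complex tangent line $T_p^{\mathbb C}H$. $M(\mathcal F,H)$ denotes the set of such points $p$. *)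

(* Defs.v *)
From Stdlib Require Export Reals.
From Coquelicot Require Export Coquelicot.

Open Scope R_scope.

Notation C2 := (C * C)%type.

(* C^2 as a real normed space; without this annotation Coquelicot's canonical
   structures read C * C as a complex normed space. *)
Notation C2_R :=
  (prod_NormedModule R_AbsRing C_R_NormedModule C_R_NormedModule).

Definition origin : C2 := (RtoC 0, RtoC 0).

Definition scal2 (c : C) (v : C2) : C2 :=
  (Cmult c (fst v), Cmult c (snd v)).

Definition translate (p : C2) (t : R) (v : C2) : C2 :=
  (Cplus (fst p) (Cmult (RtoC t) (fst v)),
   Cplus (snd p) (Cmult (RtoC t) (snd v))).

Definition closure (A : C2 -> Prop) (p : C2) : Prop :=
  forall U : C2 -> Prop, open U -> U p -> exists q, U q /\ A q.

Definition boundary (A : C2 -> Prop) (p : C2) : Prop :=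
  closure A p /\ closure (fun q => ~ A q) p.

Definition connected (A : C2 -> Prop) : Prop :=
  forall U V : C2 -> Prop, open U -> open V ->
    (forall p, A p -> U p \/ V p) ->
    (exists p, A p /\ U p) -> (exists p, A p /\ V p) ->
    exists p, A p /\ U p /\ V p.

Definition bounded (A : C2 -> Prop) : Prop :=
  exists M : R, forall p, A p -> Cmod (fst p) <= M /\ Cmod (snd p) <= M.

Definition domain (D : C2 -> Prop) : Prop :=
  open D /\ connected D /\ exists p, D p.

Definition image (f : C2 -> C2) (A : C2 -> Prop) (q : C2) : Prop :=
  exists p, A p /\ f p = q.

Definition bidisc (p : C2) : Prop := Cmod (fst p) < 1 /\ Cmod (snd p) < 1.

Definition closed_bidisc (p : C2) : Prop :=
  Cmod (fst p) <= 1 /\ Cmod (snd p) <= 1.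

Definition torus (p : C2) : Prop := Cmod (fst p) = 1 /\ Cmod (snd p) = 1.

Definition holomorphic {E : NormedModule C_AbsRing} (A : C2 -> Prop)
    (f : C2 -> E) : Prop :=
  forall p, A p -> ex_filterdiff (K := C_AbsRing) f (locally p).

Definition biholomorphism (A B : C2 -> Prop) (f g : C2 -> C2) : Prop :=
  open A /\ open B /\ holomorphic A f /\ holomorphic B g /\
  (forall p, A p -> B (f p) /\ g (f p) = p) /\
  (forall q, B q -> A (g q) /\ f (g q) = q).

Definition dirder (f : C2 -> R) (v p : C2) : R :=
  Derive (fun t => f (translate p t v)) 0.

(* C^n on an open set U: real Frechet differentiability is required at each
   order, in addition to the existence of all iterated directional
   derivatives. *)
Fixpoint Cn (n : nat) (U : C2 -> Prop) (f : C2 -> R) : Prop :=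
  match n with
  | O => forall p, U p -> continuous f p
  | S m =>
      (forall p, U p -> ex_filterdiff (U := C2_R) f (locally p)) /\
      (forall v, Cn m U (dirder f v))
  end.

Definition smooth (U : C2 -> Prop) (f : C2 -> R) : Prop :=
  forall n, Cn n U f.

Definition Cdirder (f : C2 -> C) (v p : C2) : C :=
  (dirder (fun q => Re (f q)) v p, dirder (fun q => Im (f q)) v p).

(* Wirtinger derivatives along a complex coordinate direction e. *)
Definition dW (e : C2) (f : C2 -> C) (p : C2) : C :=
  Cdiv (Cminus (Cdirder f e p) (Cmult Ci (Cdirder f (scal2 Ci e) p))) (RtoC 2).

Definition dWbar (e : C2) (f : C2 -> C) (p : C2) : C :=
  Cdiv (Cplus (Cdirder f e p) (Cmult Ci (Cdirder f (scal2 Ci e) p))) (RtoC 2).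

Definition e1 : C2 := (RtoC 1, RtoC 0).
Definition e2 : C2 := (RtoC 0, RtoC 1).

Definition levi_form (rho : C2 -> R) (p v : C2) : C :=
  let r := fun q => RtoC (rho q) in
  let term (ej ek : C2) (vj vk : C) :=
    Cmult (dW ej (dWbar ek r) p) (Cmult vj (Cconj vk)) in
  Cplus (Cplus (term e1 e1 (fst v) (fst v)) (term e1 e2 (fst v) (snd v)))
        (Cplus (term e2 e1 (snd v) (fst v)) (term e2 e2 (snd v) (snd v))).

Definition local_defining_function (D U : C2 -> Prop) (rho : C2 -> R) : Prop :=
  open U /\ smooth U rho /\
  (forall x, U x -> (D x <-> rho x < 0) /\ (boundary D x <-> rho x = 0)) /\
  (forall x, U x -> boundary D x -> exists v, dirder rho v x <> 0).

(* The equation (d rho/dz) v_1 + (d rho/dw) v_2 = 0 cuts out the complex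
   tangent line of the boundary; the Levi form is Hermitian, hence real. *)
Definition strictly_pseudoconvex_boundary (D : C2 -> Prop) : Prop :=
  forall p, boundary D p ->
    exists (U : C2 -> Prop) (rho : C2 -> R),
      U p /\ local_defining_function D U rho /\
      forall v : C2, v <> origin ->
        Cplus (Cmult (dW e1 (fun q => RtoC (rho q)) p) (fst v))
              (Cmult (dW e2 (fun q => RtoC (rho q)) p) (snd v)) = RtoC 0 ->
        0 < Re (levi_form rho p v).

(* Velocities at p of curves contained in H; for a smooth hypersurface H this
   is the real tangent space at p. *)
Definition tangent_vector (H : C2 -> Prop) (p v : C2) : Prop :=
  exists gamma : R -> C2,
    gamma 0 = p /\ locally 0 (fun t => H (gamma t)) /\
    is_derive (V := C2_R) gamma 0 v.

Definition complex_tangent_vector (H : C2 -> Prop) (p v : C2) : Prop :=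
  tangent_vector H p v /\ tangent_vector H p (scal2 Ci v).

(* A 1-form is given by its coefficients: (A, B) stands for A dz + B dw. *)
Definition pairing (eta v : C2) : C :=
  Cplus (Cmult (fst eta) (fst v)) (Cmult (snd eta) (snd v)).

(* A (possibly singular) one-dimensional holomorphic foliation of an open
   subset of C^2, as an atlas of local holomorphic 1-forms with isolated zeros
   that agree up to holomorphic units; its leaves are tangent to the kernels. *)
Record foliation := {
  fdom : C2 -> Prop;
  findex : Type;
  fchart : findex -> C2 -> Prop;
  fform : findex -> C2 -> C2;
  fchart_open : forall i, open (fchart i);
  fdom_cover : forall p, fdom p <-> exists i, fchart i p;
  fform_holomorphic : forall i, holomorphic (fchart i) (fform i);
  fform_isolated_zeros : forall i p, fchart i p -> fform i p = origin ->
    exists U : C2 -> Prop, open U /\ U p /\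
      forall q, U q -> fchart i q -> fform i q = origin -> q = p;
  fform_compatible : forall i j, exists g : C2 -> C,
    holomorphic (fun p => fchart i p /\ fchart j p) g /\
    forall p, fchart i p -> fchart j p ->
      g p <> RtoC 0 /\ fform i p = scal2 (g p) (fform j p)
}.

Definition regular_at (F : foliation) (p : C2) : Prop :=
  exists i, fchart F i p /\ fform F i p <> origin.

Definition tangent_line (F : foliation) (p v : C2) : Prop :=
  exists i, fchart F i p /\ pairing (fform F i p) v = RtoC 0.

Definition complex_tangency_set (F : foliation) (H : C2 -> Prop) (p : C2) :
    Prop :=
  H p /\ regular_at F p /\
  forall v, tangent_line F p v -> complex_tangent_vector H p v.

Definition defined_by (F : foliation) (theta : C2 -> C2) : Prop :=
  holomorphic (fdom F) theta /\
  forall i, exists g : C2 -> C,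
    holomorphic (fchart F i) g /\
    forall p, fchart F i p ->
      g p <> RtoC 0 /\ theta p = scal2 (g p) (fform F i p).

(* G = f^* F on the domain of G.  The pulled-back form may vanish along a curve
   where f is not immersive; as usual the pull-back foliation is obtained by
   dividing out the common factor h of its coefficients.  L is the complex
   differential of f at x. *)
Definition is_pullback (f : C2 -> C2) (F G : foliation) : Prop :=
  holomorphic (fdom G) f /\
  (forall q, fdom G q -> fdom F (f q)) /\
  forall i j q, fchart G j q -> fchart F i (f q) ->
    exists (W : C2 -> Prop) (h : C2 -> C),
      open W /\ W q /\ holomorphic W h /\
      (forall W' : C2 -> Prop, open W' -> (exists x, W' x) ->
         (forall x, W' x -> W x) -> exists x, W' x /\ h x <> RtoC 0) /\
      forall x, W x ->
        fchart G j x /\ fchart F i (f x) /\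
        exists L : C2 -> C2,
          filterdiff (K := C_AbsRing) f (locally x) L /\
          forall v, pairing (fform F i (f x)) (L v) =
                    Cmult (h x) (pairing (fform G j x) v).

(* The push-forward by a biholomorphism is the pull-back by its inverse. *)
Definition linearizable_of_siegel_type (F : foliation) : Prop :=
  exists (U : C2 -> Prop) (psi psi_inv : C2 -> C2) (H : foliation) (tau : R),
    U origin /\ (forall p, U p -> fdom F p) /\
    biholomorphism U (fdom H) psi psi_inv /\ psi origin = origin /\
    is_pullback psi_inv F H /\
    tau < 0 /\
    defined_by H (fun q => (Copp (Cmult (RtoC tau) (snd q)), fst q)).

(* Main.v *)
Require Import Defs.
From Stdlib Require Import Lra Lia Psatz Classical ClassicalEpsilon.

(** The quotient c = a / b is holomorphic near the closed bidisc, and everything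
    rests on the fact that it is real and positive on the torus
    ([torus_ratio]).  Granting this, the maximum principle makes Im c vanish on
    the bidisc, so c is a positive constant k ([torus_positive_constant]); the
    form (a w, b z) equals b (k w, z), and the inverse of Phi carries F to the
    foliation z dw + k w dz = 0, of Siegel type with tau = - k.

    Positivity on the torus.  At a boundary point q of D, strict
    pseudoconvexity gives a quadratic polynomial g with g (q) = 0 and
    Re g <= - eps |x - q|^2 on the closure of D near q ([levi_polynomial]).  Let
    q = Phi (z, w) with (z, w) on the torus, and restrict g o Phi to the discs
    (s z, w), (z, s w) and (s z, s w).  The derivatives l1, l2 and l1 + l2 at
    s = 1 are nonnegative real numbers, because Re g <= 0 along the discs
    ([boundary_maximum_derivative]), and l1 + l2 > 0 by the Hopf boundary lemma
    on the third disc, where Re g < 0 since Phi is injective on the bidisc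
    ([hopf_boundary]).  The differential of g at q annihilates the complex
    tangent line of the boundary ([quadratic_complex_tangent]), hence the
    direction of F; this direction is the image of (b z, - a w), so
    b l1 = a l2.  Therefore l1 and l2 are positive and a / b = l1 / l2.  The
    differential of Phi need not be invertible on the torus for this argument.

    Holomorphic means complex differentiable at each point, with no regularity
    of the derivative.  Beyond the Cauchy-Riemann equations, the only tool from
    complex analysis is the maximum principle ([maximum_principle]), derived from the invariance of circular
    means under change of radius, which is Goursat's theorem in logarithmic
    polar coordinates ([goursat], [no_strict_maximum]). *)

(** * Extreme values and Goursat's theorem by bisection *)

(** A property of rectangles x, x + k W by y, y + k H that passes from the four
    quarters to the whole, and that holds for all small enough rectangles around
    each point, holds for the initial rectangle. *)
Lemma bisection_induction (W H x0 y0 : R) (P : R -> R -> R -> Prop) :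
  0 <= W -> 0 <= H ->
  (forall x y k, 0 < k ->
     P x y (k / 2) -> P (x + k / 2 * W) y (k / 2) ->
     P x (y + k / 2 * H) (k / 2) -> P (x + k / 2 * W) (y + k / 2 * H) (k / 2) ->
     P x y k) ->
  (forall X Y, x0 <= X <= x0 + W -> y0 <= Y <= y0 + H ->
     exists delta, 0 < delta /\
       forall x y k, 0 < k < delta ->
         x0 <= x -> x + k * W <= x0 + W -> y0 <= y -> y + k * H <= y0 + H ->
         x <= X <= x + k * W -> y <= Y <= y + k * H -> P x y k) ->
  P x0 y0 1.
Proof.
intros HW HH Hquad Hloc.
apply NNPP; intros Hbad.
pose (inside := fun x y k => x0 <= x /\ x + k * W <= x0 + W /\
                             y0 <= y /\ y + k * H <= y0 + H).
(* A rectangle without the property has a quarter without it; these quarters shrink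
   to a point, where the local hypothesis is contradicted. *)
assert (Hstep : forall s : R * R, forall k, 0 < k ->
  exists s' : R * R, (inside (fst s) (snd s) k -> inside (fst s') (snd s') (k / 2)) /\
    fst s <= fst s' <= fst s + k / 2 * W /\ snd s <= snd s' <= snd s + k / 2 * H /\
    (~ P (fst s) (snd s) k -> ~ P (fst s') (snd s') (k / 2))).
{ intros [x y] k Hk; simpl.
  assert (HkW : 0 <= k / 2 * W) by (apply Rmult_le_pos; lra).
  assert (HkH : 0 <= k / 2 * H) by (apply Rmult_le_pos; lra).
  destruct (classic (P x y (k / 2))) as [H1|H1];
    [ | exists (x, y); simpl; unfold inside; repeat split; auto; lra].
  destruct (classic (P (x + k / 2 * W) y (k / 2))) as [H2|H2];
    [ | exists (x + k / 2 * W, y); simpl; unfold inside; repeat split; auto; lra].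
  destruct (classic (P x (y + k / 2 * H) (k / 2))) as [H3|H3];
    [ | exists (x, y + k / 2 * H); simpl; unfold inside; repeat split; auto; lra].
  exists (x + k / 2 * W, y + k / 2 * H); simpl; unfold inside; repeat split; auto; lra. }
assert (Hk : forall n, 0 < (/ 2) ^ n) by (intros n; apply pow_lt; lra).
pose (next := fun n s => proj1_sig (constructive_indefinite_description _
                (Hstep s ((/ 2) ^ n) (Hk n)))).
pose (sq := fix sq n := match n with O => (x0, y0) | S m => next m (sq m) end).
assert (Hsq : forall n,
  fst (sq n) <= fst (sq (S n)) <= fst (sq n) + (/ 2) ^ n / 2 * W /\
  snd (sq n) <= snd (sq (S n)) <= snd (sq n) + (/ 2) ^ n / 2 * H /\
  inside (fst (sq n)) (snd (sq n)) ((/ 2) ^ n) /\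
  ~ P (fst (sq n)) (snd (sq n)) ((/ 2) ^ n)).
{ assert (Hn : forall n,
    (inside (fst (sq n)) (snd (sq n)) ((/ 2) ^ n) ->
     inside (fst (sq (S n))) (snd (sq (S n))) ((/ 2) ^ S n)) /\
    fst (sq n) <= fst (sq (S n)) <= fst (sq n) + (/ 2) ^ n / 2 * W /\
    snd (sq n) <= snd (sq (S n)) <= snd (sq n) + (/ 2) ^ n / 2 * H /\
    (~ P (fst (sq n)) (snd (sq n)) ((/ 2) ^ n) ->
     ~ P (fst (sq (S n))) (snd (sq (S n))) ((/ 2) ^ S n))).
  { intros n. simpl sq. unfold next at 1 2 3 4 5 6 7 8.
    destruct (constructive_indefinite_description _ _) as [s' Hs']; simpl.
    replace (/ 2 * (/ 2) ^ n) with ((/ 2) ^ n / 2) by field. exact Hs'. }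
  assert (Hinv : forall n, inside (fst (sq n)) (snd (sq n)) ((/ 2) ^ n) /\
     ~ P (fst (sq n)) (snd (sq n)) ((/ 2) ^ n)).
  { induction n as [|n [I1 I2]].
    - simpl. split; [unfold inside; lra | exact Hbad].
    - destruct (Hn n) as (A1 & _ & _ & A2). split; auto. }
  intros n. destruct (Hn n) as (_ & A1 & A2 & _). destruct (Hinv n) as (A3 & A4). auto. }
assert (Hlim : forall (u : nat -> R) L, 0 <= L ->
  (forall n, u n <= u (S n) <= u n + (/ 2) ^ n / 2 * L) ->
  exists X, forall n, u n <= X <= u n + (/ 2) ^ n * L).
{ intros u L HL Hu.
  assert (Hup : forall n m, u (n + m)%nat + (/ 2) ^ (n + m) * L <= u n + (/ 2) ^ n * L).
  { intros n m; induction m as [|m IH].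
    - rewrite Nat.add_0_r; lra.
    - rewrite Nat.add_succ_r. specialize (Hu (n + m)%nat). simpl. lra. }
  assert (Hlow : forall n m, u n <= u (n + m)%nat).
  { intros n m; induction m as [|m IH].
    - rewrite Nat.add_0_r; lra.
    - rewrite Nat.add_succ_r. specialize (Hu (n + m)%nat). lra. }
  assert (Hle : forall n m, u m <= u n + (/ 2) ^ n * L).
  { intros n m. destruct (Nat.le_ge_cases n m) as [Hnm|Hnm].
    - replace m with (n + (m - n))%nat by lia.
      pose proof (Hup n (m - n)%nat).
      assert (0 <= (/ 2) ^ (n + (m - n)) * L) by (apply Rmult_le_pos; [apply Rlt_le, Hk|auto]).
      lra.
    - pose proof (Hlow m (n - m)%nat). replace (m + (n - m))%nat with n in H0 by lia.
      assert (0 <= (/ 2) ^ n * L) by (apply Rmult_le_pos; [apply Rlt_le, Hk|auto]). lra. }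
  destruct (completeness (fun r => exists n, r = u n)) as [X [HX1 HX2]].
  - exists (u O + (/ 2) ^ O * L). intros r [n ->]. apply Hle.
  - exists (u O), O; auto.
  - exists X. intros n; split.
    + apply HX1; exists n; auto.
    + apply HX2. intros r [m ->]. apply Hle. }
destruct (Hlim (fun n => fst (sq n)) W HW) as [X HX]; [intros n; apply Hsq|].
destruct (Hlim (fun n => snd (sq n)) H HH) as [Y HY]; [intros n; apply Hsq|].
destruct (Hloc X Y) as [delta [Hd Hdelta]].
- specialize (HX O); simpl in HX; lra.
- specialize (HY O); simpl in HY; lra.
- destruct (pow_lt_1_zero (/ 2)) with (y := delta) as [N HN]; auto.
  { rewrite Rabs_pos_eq; lra. }
  specialize (HN N (Nat.le_refl _)). rewrite Rabs_pos_eq in HN by (apply Rlt_le, Hk).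
  destruct (Hsq N) as (_ & _ & (I1 & I2 & I3 & I4) & HP).
  apply HP. apply Hdelta; auto.
Qed.

(** An upper semicontinuous function attains its maximum on a nonempty compact
    subset of the plane. *)
Lemma plane_maximum (u : R -> R -> R) (K : R -> R -> Prop) (M : R) :
  (forall x y, K x y -> Rabs x <= M /\ Rabs y <= M) ->
  (forall x y, ~ K x y -> exists d, 0 < d /\
     forall x' y', Rabs (x' - x) < d -> Rabs (y' - y) < d -> ~ K x' y') ->
  (forall x y, K x y -> forall eps, 0 < eps -> exists d, 0 < d /\
     forall x' y', K x' y' -> Rabs (x' - x) < d -> Rabs (y' - y) < d ->
       u x' y' < u x y + eps) ->
  (exists x y, K x y) ->
  exists x y, K x y /\ forall x' y', K x' y' -> u x' y' <= u x y.
Proof.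
intros HM Hcl Hu (a & b & Hab).
apply NNPP; intros Hno.
assert (Hup : forall x y, K x y -> exists x' y', K x' y' /\ u x y < u x' y').
{ intros x y Hxy. apply NNPP; intros Hn. apply Hno. exists x, y; split; auto.
  intros x' y' H'. apply Rnot_lt_le; intros Hl. apply Hn. exists x', y'; auto. }
assert (HM0 : 0 <= M) by (destruct (HM a b Hab) as [? _]; pose proof (Rabs_pos a); lra).
(* If the maximum is not attained, each small rectangle has its values on K strictly
   below some value u (a', b') with (a', b') in K, and so has the whole square. *)
pose (P := fun x y k => exists a' b', K a' b' /\
  forall x' y', K x' y' -> x <= x' <= x + k * (2 * M) -> y <= y' <= y + k * (2 * M) ->
    u x' y' < u a' b').
assert (HP : P (- M) (- M) 1).
{ apply (bisection_induction (2 * M) (2 * M)); try lra.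
  - intros x y k Hk (a1 & b1 & K1 & H1) (a2 & b2 & K2 & H2)
      (a3 & b3 & K3 & H3) (a4 & b4 & K4 & H4).
    assert (Hmax : forall p q : R * R, exists r : R * R, (r = p \/ r = q) /\
       u (fst p) (snd p) <= u (fst r) (snd r) /\ u (fst q) (snd q) <= u (fst r) (snd r)).
    { intros p q. destruct (Rle_dec (u (fst p) (snd p)) (u (fst q) (snd q))).
      - exists q; repeat split; auto; lra.
      - exists p; repeat split; auto; lra. }
    destruct (Hmax (a1, b1) (a2, b2)) as (r1 & E1 & L1 & L2).
    destruct (Hmax (a3, b3) (a4, b4)) as (r2 & E2 & L3 & L4).
    destruct (Hmax r1 r2) as (r & E & L5 & L6). simpl in *.
    exists (fst r), (snd r). split.
    + destruct E as [->| ->]; [destruct E1 as [->| ->]|destruct E2 as [->| ->]]; auto.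
    + intros x' y' K' Hx Hy.
      destruct (Rle_dec x' (x + k / 2 * (2 * M)));
      destruct (Rle_dec y' (y + k / 2 * (2 * M))).
      * specialize (H1 x' y' K'). lra.
      * specialize (H3 x' y' K'). lra.
      * specialize (H2 x' y' K'). lra.
      * specialize (H4 x' y' K'). lra.
  - intros X Y HX HY.
    assert (Hd : exists a' b', K a' b' /\ exists d, 0 < d /\ forall x' y', K x' y' ->
       Rabs (x' - X) < d -> Rabs (y' - Y) < d -> u x' y' < u a' b').
    { destruct (classic (K X Y)) as [HK|HK].
      - destruct (Hup X Y HK) as (a' & b' & K' & Hl).
        destruct (Hu X Y HK (u a' b' - u X Y)) as (d & Hd & Hd'); [lra|].
        exists a', b'; split; auto. exists d; split; auto.
        intros x' y' Kx H1 H2. specialize (Hd' x' y' Kx H1 H2). lra.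
      - destruct (Hcl X Y HK) as (d & Hd & Hd').
        exists a, b; split; auto. exists d; split; auto.
        intros x' y' Kx H1 H2. exfalso. apply (Hd' x' y'); auto. }
    destruct Hd as (a' & b' & K' & d & Hd & Hd').
    exists (d / (2 * M + 1)). split; [apply Rdiv_lt_0_compat; lra|].
    intros x y k [Hk1 Hk2] _ _ _ _ HXx HYy.
    exists a', b'; split; auto.
    assert (Hkd : k * (2 * M) < d).
    { apply Rlt_div_r in Hk2; lra. }
    intros x' y' Kx H1 H2. apply Hd'; auto; apply Rabs_def1; lra. }
destruct HP as (a' & b' & K' & H').
destruct (HM a' b' K') as [B1 B2].
apply Rabs_le_between in B1. apply Rabs_le_between in B2.
specialize (H' a' b' K'). lra.
Qed.

(** Circulation of the real 1-form P dx + Q dy around the rectangle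
    a <= x <= b, c <= y <= d. *)
Definition circulation (P Q : R -> R -> R) (a b c d : R) : R :=
  RInt (fun x => P x c) a b + RInt (fun y => Q b y) c d
  - RInt (fun x => P x d) a b - RInt (fun y => Q a y) c d.

Lemma RInt_near_derivative (f g phi : R -> R) (a b M : R) :
  a <= b -> ex_RInt f a b ->
  (forall x, is_derive phi x (g x)) -> (forall x, continuous g x) ->
  (forall x, a <= x <= b -> Rabs (f x - g x) <= M) ->
  Rabs (RInt f a b - (phi b - phi a)) <= M * (b - a).
Proof.
intros Hab Hf Hphi Hg HM.
assert (Hig : is_RInt g a b (phi b - phi a)).
{ apply (is_RInt_derive phi g); auto. }
rewrite <- (is_RInt_unique _ _ _ _ Hig).
assert (Hm : RInt (fun x => f x - g x) a b = RInt f a b - RInt g a b).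
{ apply (RInt_minus f g); auto. eexists; apply Hig. }
rewrite <- Hm.
rewrite Rmult_comm. apply abs_RInt_le_const; auto.
apply (ex_RInt_minus f g); auto. eexists; apply Hig.
Qed.

Lemma differentiable_continuous_slice (P : R -> R -> R) x y p1 p2 :
  differentiable_pt_lim P x y p1 p2 -> continuous (fun x => P x y) x.
Proof.
intros H. apply (ex_derive_continuous (fun x => P x y)).
exists p1. rewrite is_derive_Reals. intros eps Heps.
destruct (H (mkposreal (eps / 2) ltac:(lra))) as [d Hd].
exists d. intros h Hh Hhd. simpl in Hd.
specialize (Hd (x + h) y).
replace (x + h - x) with h in Hd by ring.
rewrite (Rminus_diag_eq y y) in Hd by auto. rewrite Rabs_R0 in Hd.
specialize (Hd Hhd (cond_pos d)).
rewrite Rmax_left in Hd by apply Rabs_pos.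
assert (Hh' : 0 < Rabs h) by (apply Rabs_pos_lt; auto).
replace ((P (x + h) y - P x y) / h - p1)
  with ((P (x + h) y - P x y - (p1 * h + p2 * 0)) / h) by (field; auto).
unfold Rdiv at 1. rewrite Rabs_mult, Rabs_inv.
apply Rle_lt_trans with (eps / 2); [|lra].
apply Rmult_le_reg_r with (Rabs h); auto.
rewrite Rmult_assoc, Rinv_l by lra. lra.
Qed.

Lemma differentiable_swap (P : R -> R -> R) x y p1 p2 :
  differentiable_pt_lim P x y p1 p2 ->
  differentiable_pt_lim (fun y x => P x y) y x p2 p1.
Proof.
intros H eps. destruct (H eps) as [d Hd]. exists d. intros u v Hu Hv.
rewrite Rmax_comm.
replace (p2 * (u - y) + p1 * (v - x)) with (p1 * (v - x) + p2 * (u - y)) by ring.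
apply Hd; auto.
Qed.

Lemma circulation_quarters (P Q : R -> R -> R) (a m b c n d : R) :
  a <= m <= b -> c <= n <= d ->
  (forall x y, a <= x <= b -> c <= y <= d -> continuous (fun x => P x y) x) ->
  (forall x y, a <= x <= b -> c <= y <= d -> continuous (fun y => Q x y) y) ->
  circulation P Q a b c d =
    circulation P Q a m c n + circulation P Q m b c n +
    circulation P Q a m n d + circulation P Q m b n d.
Proof.
intros Hm Hn HP HQ.
assert (CP : forall y, c <= y <= d ->
  RInt (fun x => P x y) a b = RInt (fun x => P x y) a m + RInt (fun x => P x y) m b).
{ intros y Hy. symmetry. apply (RInt_Chasles (fun x => P x y));
  apply (ex_RInt_continuous (V := R_CompleteNormedModule)); intros z Hz;
  rewrite Rmin_left, Rmax_right in Hz by lra; apply HP; lra. }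
assert (CQ : forall x, a <= x <= b ->
  RInt (fun y => Q x y) c d = RInt (fun y => Q x y) c n + RInt (fun y => Q x y) n d).
{ intros x Hx. symmetry. apply (RInt_Chasles (fun y => Q x y));
  apply (ex_RInt_continuous (V := R_CompleteNormedModule)); intros z Hz;
  rewrite Rmin_left, Rmax_right in Hz by lra; apply HQ; lra. }
unfold circulation.
rewrite (CP c), (CP d), (CQ a), (CQ b) by lra. ring.
Qed.

(** Goursat's theorem for real 1-forms: if P dx + Q dy is differentiable and
    closed at each point of a rectangle, with no continuity of the derivatives,
    then its circulation is 0. *)
Lemma goursat (P Q : R -> R -> R) (a b c d : R) :
  a <= b -> c <= d ->
  (forall x y, a <= x <= b -> c <= y <= d -> exists p1 p2 q2,
     differentiable_pt_lim P x y p1 p2 /\ differentiable_pt_lim Q x y p2 q2) ->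
  circulation P Q a b c d = 0.
Proof.
intros Hab Hcd Hdiff.
assert (HcP : forall x y, a <= x <= b -> c <= y <= d -> continuous (fun x => P x y) x).
{ intros x y Hx Hy. destruct (Hdiff x y Hx Hy) as (p1 & p2 & q2 & H1 & H2).
  apply (differentiable_continuous_slice P x y p1 p2); auto. }
assert (HcQ : forall x y, a <= x <= b -> c <= y <= d -> continuous (fun y => Q x y) y).
{ intros x y Hx Hy. destruct (Hdiff x y Hx Hy) as (p1 & p2 & q2 & H1 & H2).
  apply (differentiable_continuous_slice (fun y x => Q x y) y x q2 p2).
  apply differentiable_swap; auto. }
apply NNPP; intros Hnz.
set (W := b - a). set (H := d - c).
assert (HW : 0 <= W) by (unfold W; lra). assert (HH : 0 <= H) by (unfold H; lra).
set (eps := Rabs (circulation P Q a b c d) / 2).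
assert (Heps : 0 < eps) by (unfold eps; apply Rabs_pos_lt in Hnz; lra).
cut (Rabs (circulation P Q a (a + 1 * W) c (c + 1 * H)) <= eps * 1 ^ 2).
{ replace (a + 1 * W) with b by (unfold W; ring).
  replace (c + 1 * H) with d by (unfold H; ring).
  unfold eps. apply Rabs_pos_lt in Hnz. lra. }
(* The circulation of a small rectangle around a point is o(k^2), since that of the
   first-order expansion of the form is 0. *)
pose (S := fun x y k => a <= x -> x + k * W <= a + W -> c <= y -> y + k * H <= c + H ->
  Rabs (circulation P Q x (x + k * W) y (y + k * H)) <= eps * k ^ 2).
cut (S a c 1); [intros HS; apply HS; lra|].
apply (bisection_induction W H); auto.
- intros x y k Hk H1 H2 H3 H4 B1 B2 B3 B4.
  assert (HkW : 0 <= k / 2 * W) by (apply Rmult_le_pos; lra).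
  assert (HkH : 0 <= k / 2 * H) by (apply Rmult_le_pos; lra).
  rewrite (circulation_quarters P Q x (x + k / 2 * W) (x + k * W)
             y (y + k / 2 * H) (y + k * H)); try lra.
  + unfold S in H1, H2, H3, H4.
    replace (x + k / 2 * W + k / 2 * W) with (x + k * W) in H2, H4 by field.
    replace (y + k / 2 * H + k / 2 * H) with (y + k * H) in H3, H4 by field.
    specialize (H1 ltac:(lra) ltac:(lra) ltac:(lra) ltac:(lra)).
    specialize (H2 ltac:(lra) ltac:(lra) ltac:(lra) ltac:(lra)).
    specialize (H3 ltac:(lra) ltac:(lra) ltac:(lra) ltac:(lra)).
    specialize (H4 ltac:(lra) ltac:(lra) ltac:(lra) ltac:(lra)).
    apply Rabs_le_between in H1. apply Rabs_le_between in H2.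
    apply Rabs_le_between in H3. apply Rabs_le_between in H4.
    replace (eps * (k / 2) ^ 2) with (eps * k ^ 2 / 4) in * by field.
    apply Rabs_le; lra.
  + intros x' y' Hx Hy; apply HcP; unfold W, H in *; lra.
  + intros x' y' Hx Hy; apply HcQ; unfold W, H in *; lra.
- intros X Y HX HY.
  destruct (Hdiff X Y) as (p1 & p2 & q2 & DP & DQ); [unfold W in *; lra|unfold H in *; lra|].
  set (eta := eps / (2 * (W + H) ^ 2 + 1)).
  assert (Hden : 0 < 2 * (W + H) ^ 2 + 1) by (pose proof (pow2_ge_0 (W + H)); lra).
  assert (Heta : 0 < eta) by (apply Rdiv_lt_0_compat; auto).
  destruct (DP (mkposreal eta Heta)) as [d1 Hd1].
  destruct (DQ (mkposreal eta Heta)) as [d2 Hd2]. simpl in Hd1, Hd2.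
  set (dm := Rmin d1 d2 / (W + H + 1)).
  exists dm. split.
  { apply Rdiv_lt_0_compat; [|lra]. apply Rmin_pos; apply cond_pos. }
  intros x y k [Hk1 Hk2] A1 A2 A3 A4 HXx HYy _ _ _ _.
  assert (Hkd : k * (W + H + 1) < Rmin d1 d2) by (apply Rlt_div_r in Hk2; lra).
  pose proof (Rmin_l d1 d2). pose proof (Rmin_r d1 d2).
  assert (HkW : 0 <= k * W) by (apply Rmult_le_pos; lra).
  assert (HkH : 0 <= k * H) by (apply Rmult_le_pos; lra).
  assert (HM : forall x' y', x <= x' <= x + k * W -> y <= y' <= y + k * H ->
    Rabs (P x' y' - (P X Y + p1 * (x' - X) + p2 * (y' - Y))) <= eta * (k * (W + H)) /\
    Rabs (Q x' y' - (Q X Y + p2 * (x' - X) + q2 * (y' - Y))) <= eta * (k * (W + H))).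
  { intros x' y' Hx' Hy'.
    assert (B1 : Rabs (x' - X) <= k * W) by (apply Rabs_le; lra).
    assert (B2 : Rabs (y' - Y) <= k * H) by (apply Rabs_le; lra).
    assert (BM : Rmax (Rabs (x' - X)) (Rabs (y' - Y)) <= k * (W + H)).
    { apply Rmax_lub; lra. }
    specialize (Hd1 x' y' ltac:(lra) ltac:(lra)).
    specialize (Hd2 x' y' ltac:(lra) ltac:(lra)).
    split; eapply Rle_trans; [|apply Rmult_le_compat_l, BM; lra
                              | |apply Rmult_le_compat_l, BM; lra].
    - replace (P x' y' - (P X Y + p1 * (x' - X) + p2 * (y' - Y)))
        with (P x' y' - P X Y - (p1 * (x' - X) + p2 * (y' - Y))) by ring. auto.
    - replace (Q x' y' - (Q X Y + p2 * (x' - X) + q2 * (y' - Y)))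
        with (Q x' y' - Q X Y - (p2 * (x' - X) + q2 * (y' - Y))) by ring. auto. }
  (* Antiderivatives of the affine parts of P and Q along the sides. *)
  assert (IP : forall y', y <= y' <= y + k * H ->
    Rabs (RInt (fun x => P x y') x (x + k * W) -
      ((P X Y * (x + k * W) + p1 * (x + k * W - X) ^ 2 / 2 + p2 * (y' - Y) * (x + k * W)) -
       (P X Y * x + p1 * (x - X) ^ 2 / 2 + p2 * (y' - Y) * x)))
    <= eta * (k * (W + H)) * (x + k * W - x)).
  { intros y' Hy'.
    apply (RInt_near_derivative (fun x => P x y')
       (fun x' => P X Y + p1 * (x' - X) + p2 * (y' - Y))
       (fun x' => P X Y * x' + p1 * (x' - X) ^ 2 / 2 + p2 * (y' - Y) * x')).
    - lra.
    - apply (ex_RInt_continuous (V := R_CompleteNormedModule)). intros z Hz.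
      rewrite Rmin_left, Rmax_right in Hz by lra. apply HcP; unfold W, H in *; lra.
    - intros z. auto_derive; auto; field.
    - intros z. apply (ex_derive_continuous (fun x' => P X Y + p1 * (x' - X) + p2 * (y' - Y))).
      auto_derive; auto.
    - intros z Hz. apply HM; lra. }
  assert (IQ : forall x', x <= x' <= x + k * W ->
    Rabs (RInt (fun y => Q x' y) y (y + k * H) -
      ((Q X Y * (y + k * H) + p2 * (x' - X) * (y + k * H) + q2 * (y + k * H - Y) ^ 2 / 2) -
       (Q X Y * y + p2 * (x' - X) * y + q2 * (y - Y) ^ 2 / 2)))
    <= eta * (k * (W + H)) * (y + k * H - y)).
  { intros x' Hx'.
    apply (RInt_near_derivative (fun y => Q x' y)
       (fun y' => Q X Y + p2 * (x' - X) + q2 * (y' - Y))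
       (fun y' => Q X Y * y' + p2 * (x' - X) * y' + q2 * (y' - Y) ^ 2 / 2)).
    - lra.
    - apply (ex_RInt_continuous (V := R_CompleteNormedModule)). intros z Hz.
      rewrite Rmin_left, Rmax_right in Hz by lra. apply HcQ; unfold W, H in *; lra.
    - intros z. auto_derive; auto; field.
    - intros z. apply (ex_derive_continuous (fun y' => Q X Y + p2 * (x' - X) + q2 * (y' - Y))).
      auto_derive; auto.
    - intros z Hz. apply HM; lra. }
  pose proof (IP y ltac:(lra)) as I1. pose proof (IP (y + k * H) ltac:(lra)) as I2.
  pose proof (IQ x ltac:(lra)) as I3. pose proof (IQ (x + k * W) ltac:(lra)) as I4.
  apply Rabs_le_between in I1. apply Rabs_le_between in I2.
  apply Rabs_le_between in I3. apply Rabs_le_between in I4.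
  assert (Hfin : eta * (k * (W + H)) * (2 * (k * W) + 2 * (k * H)) <= eps * k ^ 2).
  { replace (eta * (k * (W + H)) * (2 * (k * W) + 2 * (k * H)))
      with (eta * (2 * (W + H) ^ 2) * k ^ 2) by ring.
    apply Rmult_le_compat_r; [apply pow2_ge_0|].
    replace eps with (eta * (2 * (W + H) ^ 2 + 1)) by (unfold eta; field; lra).
    apply Rmult_le_compat_l; lra. }
  unfold circulation. apply Rabs_le. lra.
Qed.

(** * Complex derivatives *)

Lemma im_le_Cmod (z : C) : Rabs (Im z) <= Cmod z.
Proof. eapply Rle_trans; [apply Rmax_r|apply Rmax_Cmod]. Qed.

Lemma Cmod_le_2Rmax (z : C) : Cmod z <= 2 * Rmax (Rabs (Re z)) (Rabs (Im z)).
Proof.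
eapply Rle_trans; [apply Cmod_2Rmax|].
apply Rmult_le_compat_r.
- eapply Rle_trans; [apply Rabs_pos|apply Rmax_l].
- apply Rle_trans with (sqrt (2 * 2)); [apply sqrt_le_1_alt; lra|].
  rewrite sqrt_square; lra.
Qed.

Lemma real_complex (z : C) : Im z = 0 -> z = RtoC (Re z).
Proof.
intros Hz. rewrite (surjective_pairing z) at 1. unfold RtoC, Re, Im in *. f_equal; auto.
Qed.

(** The number l is the complex derivative of f at z. *)
Definition cdiff (f : C -> C) (z l : C) : Prop :=
  forall eps, 0 < eps -> exists delta, 0 < delta /\
    forall h, Cmod h < delta ->
      Cmod (f (z + h) - f z - l * h)%C <= eps * Cmod h.

Lemma cdiff_lipschitz (f : C -> C) z l :
  cdiff f z l -> exists d, 0 < d /\ forall h, Cmod h < d ->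
    Cmod (f (z + h) - f z)%C <= (Cmod l + 1) * Cmod h.
Proof.
intros H. destruct (H 1 ltac:(lra)) as (d & Hd & Hf).
exists d; split; auto. intros h Hh. specialize (Hf h Hh).
replace (f (z + h) - f z)%C with ((f (z + h) - f z - l * h) + l * h)%C by ring.
eapply Rle_trans; [apply Cmod_triangle|]. rewrite Cmod_mult. lra.
Qed.

Lemma cdiff_const (c z : C) : cdiff (fun _ => c) z 0.
Proof.
intros eps He. exists 1; split; [lra|]. intros h _.
replace (c - c - 0 * h)%C with (RtoC 0) by ring. rewrite Cmod_0.
pose proof (Cmod_ge_0 h). nra.
Qed.

Lemma cdiff_plus (f g : C -> C) z l m :
  cdiff f z l -> cdiff g z m -> cdiff (fun z => f z + g z)%C z (l + m)%C.
Proof.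
intros Hf Hg eps He.
destruct (Hf (eps / 2) ltac:(lra)) as (d1 & Hd1 & H1).
destruct (Hg (eps / 2) ltac:(lra)) as (d2 & Hd2 & H2).
exists (Rmin d1 d2). split; [apply Rmin_pos; auto|]. intros h Hh.
specialize (H1 h (Rlt_le_trans _ _ _ Hh (Rmin_l _ _))).
specialize (H2 h (Rlt_le_trans _ _ _ Hh (Rmin_r _ _))).
replace (f (z + h) + g (z + h) - (f z + g z) - (l + m) * h)%C
  with ((f (z + h) - f z - l * h) + (g (z + h) - g z - m * h))%C by ring.
eapply Rle_trans; [apply Cmod_triangle|lra].
Qed.

Lemma cdiff_scal (c : C) (f : C -> C) z l :
  cdiff f z l -> cdiff (fun z => c * f z)%C z (c * l)%C.
Proof.
intros H eps He. pose proof (Cmod_ge_0 c).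
destruct (H (eps / (Cmod c + 1))) as (d & Hd & Hf).
{ apply Rdiv_lt_0_compat; lra. }
exists d; split; auto. intros h Hh. specialize (Hf h Hh).
replace (c * f (z + h) - c * f z - c * l * h)%C
  with (c * (f (z + h) - f z - l * h))%C by ring.
rewrite Cmod_mult.
apply Rle_trans with (Cmod c * (eps / (Cmod c + 1) * Cmod h)).
{ apply Rmult_le_compat_l; auto. }
replace (Cmod c * (eps / (Cmod c + 1) * Cmod h))
  with (Cmod c / (Cmod c + 1) * (eps * Cmod h)) by (field; lra).
rewrite <- (Rmult_1_l (eps * Cmod h)) at 2.
apply Rmult_le_compat_r.
- pose proof (Cmod_ge_0 h). nra.
- apply Rle_div_l; lra.
Qed.

Lemma cdiff_mult (f g : C -> C) z l m :
  cdiff f z l -> cdiff g z m ->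
  cdiff (fun z => f z * g z)%C z (l * g z + f z * m)%C.
Proof.
intros Hf Hg.
destruct (cdiff_lipschitz _ _ _ Hf) as (d0 & Hd0 & Hlip).
pose proof (Cmod_ge_0 l) as Hl. pose proof (Cmod_ge_0 m) as Hm.
pose proof (Cmod_ge_0 (f z)) as Hfz. pose proof (Cmod_ge_0 (g z)) as Hgz.
set (A := Cmod (g z) + Cmod (f z) + (Cmod l + 1) * (Cmod m + 1)).
assert (HA : 0 < A) by (unfold A; nra).
intros eps He.
assert (He1 : 0 < Rmin 1 (eps / (2 * A))) by (apply Rmin_pos; [lra|apply Rdiv_lt_0_compat; lra]).
destruct (Hf _ He1) as (d1 & Hd1 & H1). destruct (Hg _ He1) as (d2 & Hd2 & H2).
set (e := Rmin 1 (eps / (2 * A))) in *.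
assert (He2 : e <= 1) by apply Rmin_l.
assert (He3 : A * e <= eps / 2).
{ pose proof (Rmin_r 1 (eps / (2 * A))) as Hr. fold e in Hr.
  apply Rmult_le_compat_l with (r := A) in Hr; [|lra].
  replace (A * (eps / (2 * A))) with (eps / 2) in Hr by (field; lra). exact Hr. }
exists (Rmin (Rmin d0 e) (Rmin d1 d2)).
split; [apply Rmin_pos; apply Rmin_pos; auto|].
intros h Hh.
pose proof (Rmin_l (Rmin d0 e) (Rmin d1 d2)). pose proof (Rmin_r (Rmin d0 e) (Rmin d1 d2)).
pose proof (Rmin_l d0 e). pose proof (Rmin_r d0 e).
pose proof (Rmin_l d1 d2). pose proof (Rmin_r d1 d2).
specialize (H1 h ltac:(lra)). specialize (H2 h ltac:(lra)). specialize (Hlip h ltac:(lra)).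
pose proof (Cmod_ge_0 h) as Hh0.
replace (f (z + h) * g (z + h) - f z * g z - (l * g z + f z * m) * h)%C
  with ((f (z + h) - f z - l * h) * g z + f z * (g (z + h) - g z - m * h) +
        (f (z + h) - f z) * (m * h + (g (z + h) - g z - m * h)))%C by ring.
assert (H7 : Cmod (m * h + (g (z + h) - g z - m * h))%C <= (Cmod m + 1) * Cmod h).
{ eapply Rle_trans; [apply Cmod_triangle|]. rewrite Cmod_mult. nra. }
eapply Rle_trans; [apply Cmod_triangle|].
eapply Rle_trans; [apply Rplus_le_compat_r, Cmod_triangle|].
rewrite !Cmod_mult.
assert (T1 : Cmod (f (z + h) - f z - l * h)%C * Cmod (g z) <= e * Cmod h * Cmod (g z))
  by (apply Rmult_le_compat_r; auto).
assert (T2 : Cmod (f z) * Cmod (g (z + h) - g z - m * h)%C <= Cmod (f z) * (e * Cmod h))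
  by (apply Rmult_le_compat_l; auto).
assert (T3 : Cmod (f (z + h) - f z)%C * Cmod (m * h + (g (z + h) - g z - m * h))%C <=
  ((Cmod l + 1) * Cmod h) * ((Cmod m + 1) * Cmod h))
  by (apply Rmult_le_compat; auto; apply Cmod_ge_0).
assert (T4 : ((Cmod l + 1) * Cmod h) * ((Cmod m + 1) * Cmod h) <=
  ((Cmod l + 1) * (Cmod m + 1)) * (e * Cmod h)).
{ replace (((Cmod l + 1) * Cmod h) * ((Cmod m + 1) * Cmod h))
    with (((Cmod l + 1) * (Cmod m + 1)) * (Cmod h * Cmod h)) by ring.
  apply Rmult_le_compat_l; [nra|]. apply Rmult_le_compat_r; lra. }
apply Rle_trans with (A * e * Cmod h); [unfold A; lra|].
apply Rmult_le_compat_r; lra.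
Qed.

Lemma cdiff_quadratic (c0 c1 c2 z : C) :
  cdiff (fun z => c0 + c1 * z + c2 * z * z)%C z (c1 + 2 * c2 * z)%C.
Proof.
intros eps He. pose proof (Cmod_ge_0 c2).
exists (eps / (Cmod c2 + 1)). split; [apply Rdiv_lt_0_compat; lra|].
intros h Hh.
replace (c0 + c1 * (z + h) + c2 * (z + h) * (z + h) - (c0 + c1 * z + c2 * z * z) -
  (c1 + 2 * c2 * z) * h)%C with (c2 * h * h)%C by ring.
rewrite !Cmod_mult. apply Rmult_le_compat_r; [apply Cmod_ge_0|].
apply Rlt_div_r in Hh; [|lra]. pose proof (Cmod_ge_0 h). nra.
Qed.

Lemma cdiff_translate (f : C -> C) a z l :
  cdiff f (a + z)%C l -> cdiff (fun z => f (a + z)%C) z l.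
Proof.
intros H eps He. destruct (H eps He) as (d & Hd & Hf).
exists d; split; auto. intros h Hh. rewrite Cplus_assoc; auto.
Qed.

Lemma cdiff_real_parts (f : C -> C) x y (l : C) :
  cdiff f (x, y) l ->
  differentiable_pt_lim (fun x y => Re (f (x, y))) x y (Re l) (- Im l) /\
  differentiable_pt_lim (fun x y => Im (f (x, y))) x y (Im l) (Re l).
Proof.
intros H.
assert (G : forall eps : posreal, exists d : posreal, forall u v,
  Rabs (u - x) < d -> Rabs (v - y) < d ->
  Cmod (f (u, v) - f (x, y) - l * ((u - x)%R, (v - y)%R))%C
   <= eps * Rmax (Rabs (u - x)) (Rabs (v - y))).
{ intros eps. destruct (H (eps / 2)) as (d & Hd & Hf).
  { pose proof (cond_pos eps); lra. }
  exists (mkposreal (d / 2) ltac:(lra)). simpl. intros u v Hu Hv.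
  pose proof (Cmod_le_2Rmax (u - x, v - y)) as Hm. simpl in Hm.
  assert (Rmax (Rabs (u - x)) (Rabs (v - y)) < d / 2) by (apply Rmax_lub_lt; auto).
  specialize (Hf (u - x, v - y) ltac:(lra)).
  replace ((x, y) + ((u - x)%R, (v - y)%R))%C with (u, v) in Hf
    by (unfold Cplus; simpl; f_equal; ring).
  eapply Rle_trans; [exact Hf|].
  pose proof (cond_pos eps). nra. }
split; intros eps; destruct (G eps) as [d Hd]; exists d; intros u v Hu Hv;
  specialize (Hd u v Hu Hv); eapply Rle_trans; try exact Hd.
- eapply Rle_trans; [|apply re_le_Cmod]. apply Req_le; f_equal. unfold Re, Im; simpl. ring.
- eapply Rle_trans; [|apply im_le_Cmod]. apply Req_le; f_equal. unfold Re, Im; simpl. ring.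
Qed.

(** For f = U + i V, the form V dt + U ds is the imaginary part of
    f (exp zeta) d zeta with zeta = t + i s; it is closed by the Cauchy-Riemann
    equations. *)
Lemma cdiff_polar (f : C -> C) t s (l : C) :
  cdiff f (exp t * cos s, exp t * sin s) l ->
  exists p1 p2 q2,
  differentiable_pt_lim (fun t s => Im (f (exp t * cos s, exp t * sin s))) t s p1 p2 /\
  differentiable_pt_lim (fun t s => Re (f (exp t * cos s, exp t * sin s))) t s p2 q2.
Proof.
intros H. destruct (cdiff_real_parts _ _ _ _ H) as [HR HI].
assert (Hmul : forall a b, differentiable_pt_lim (fun a b => a * b) a b b a).
{ intros a b eps. exists eps. intros u v Hu Hv.
  replace (u * v - a * b - (b * (u - a) + a * (v - b))) with ((u - a) * (v - b)) by ring.
  rewrite Rabs_mult. apply Rmult_le_compat; try apply Rabs_pos; [lra|apply Rmax_r]. }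
assert (Hexp : differentiable_pt_lim (fun t _ => exp t) t s (exp t) 0).
{ apply differentiable_pt_lim_proj1_0, derivable_pt_lim_exp. }
assert (Hcos : differentiable_pt_lim (fun _ s => cos s) t s 0 (- sin s)).
{ apply (differentiable_swap (fun s _ => cos s)),
    differentiable_pt_lim_proj1_0, derivable_pt_lim_cos. }
assert (Hsin : differentiable_pt_lim (fun _ s => sin s) t s 0 (cos s)).
{ apply (differentiable_swap (fun s _ => sin s)),
    differentiable_pt_lim_proj1_0, derivable_pt_lim_sin. }
pose proof (differentiable_pt_lim_comp _ _ _ t s _ _ _ _ _ _ (Hmul _ _) Hexp Hcos) as HX.
pose proof (differentiable_pt_lim_comp _ _ _ t s _ _ _ _ _ _ (Hmul _ _) Hexp Hsin) as HY.
pose proof (differentiable_pt_lim_comp _ _ _ t s _ _ _ _ _ _ HR HX HY) as DR.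
pose proof (differentiable_pt_lim_comp _ _ _ t s _ _ _ _ _ _ HI HX HY) as DI.
cbv beta in DR, DI.
eexists _, _, _. split; [exact DI|].
eapply eq_ind with (P := fun r => differentiable_pt_lim _ t s r _); [exact DR|ring].
Qed.

Lemma Cmod_polar t s : Cmod (exp t * cos s, exp t * sin s) = exp t.
Proof.
unfold Cmod; simpl.
replace (exp t * cos s * (exp t * cos s * 1) + exp t * sin s * (exp t * sin s * 1))
  with (Rsqr (exp t) * (Rsqr (sin s) + Rsqr (cos s))) by (unfold Rsqr; ring).
rewrite sin2_cos2, Rmult_1_r. apply sqrt_Rsqr, Rlt_le, exp_pos.
Qed.

(** * Maximum principle *)

(** The integral of Re f (exp (t + i s)) over 0 <= s <= 2 pi does not depend on
    t, by Goursat's theorem and periodicity.  It tends to 0 as t goes to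
    minus infinity, which contradicts a negative upper bound on a circle. *)
Lemma no_strict_maximum (f : C -> C) (r eps : R) :
  0 < r -> 0 < eps ->
  (forall h, Cmod h < r -> exists l, cdiff f h l) ->
  f 0 = 0 ->
  ~ (forall h, Cmod h < r -> Re (f h) <= - eps * Cmod h ^ 2).
Proof.
intros Hr He Hf Hf0 Hneg.
(* Logarithmic polar coordinates: the rectangle t0 <= t <= t1, 0 <= s <= 2 pi. *)
set (P := fun t s => Im (f (exp t * cos s, exp t * sin s))).
set (Q := fun t s => Re (f (exp t * cos s, exp t * sin s))).
set (eta := eps * (r / 2) ^ 2 / 2).
assert (Hrr : 0 < eps * (r / 2) ^ 2) by (apply Rmult_lt_0_compat; [auto|apply pow_lt; lra]).
assert (Hsmall : exists d, 0 < d /\ forall h, Cmod h < d -> Cmod (f h) <= eta).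
{ destruct (Hf 0) as [l Hl]; [rewrite Cmod_0; auto|].
  destruct (cdiff_lipschitz _ _ _ Hl) as (d & Hd & Hd').
  pose proof (Cmod_ge_0 l).
  exists (Rmin d (eta / (Cmod l + 1))). split.
  { apply Rmin_pos; auto. apply Rdiv_lt_0_compat; unfold eta; lra. }
  intros h Hh. specialize (Hd' h (Rlt_le_trans _ _ _ Hh (Rmin_l _ _))).
  replace (f h) with (f (0 + h) - f 0)%C by (rewrite Hf0, Cplus_0_l; ring).
  eapply Rle_trans; [exact Hd'|].
  pose proof (Rlt_le_trans _ _ _ Hh (Rmin_r _ _)) as H2.
  apply Rlt_le in H2. apply Rmult_le_compat_l with (r := Cmod l + 1) in H2; [|lra].
  replace ((Cmod l + 1) * (eta / (Cmod l + 1))) with eta in H2 by (field; lra). lra. }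
destruct Hsmall as (d & Hd & Hsmall).
set (t1 := ln (r / 2)). set (t0 := Rmin t1 (ln (d / 2))).
assert (Ht1 : exp t1 = r / 2) by (apply exp_ln; lra).
assert (Ht0 : exp t0 < d).
{ apply Rle_lt_trans with (exp (ln (d / 2))).
  - destruct (Rle_lt_or_eq_dec _ _ (Rmin_r t1 (ln (d / 2)))) as [Hl|Hl].
    + apply Rlt_le, exp_increasing, Hl.
    + unfold t0; rewrite Hl; lra.
  - rewrite exp_ln; lra. }
assert (Ht01 : t0 <= t1) by apply Rmin_l.
assert (Hdiff : forall t s, t <= t1 -> exists p1 p2 q2,
  differentiable_pt_lim P t s p1 p2 /\ differentiable_pt_lim Q t s p2 q2).
{ intros t s Ht. destruct (Hf (exp t * cos s, exp t * sin s)) as [l Hl].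
  - rewrite Cmod_polar. apply Rle_lt_trans with (exp t1); [|lra].
    destruct Ht as [Ht| ->]; [apply Rlt_le, exp_increasing, Ht|lra].
  - apply (cdiff_polar f t s l Hl). }
pose proof PI_RGT_0 as HPI.
pose proof (goursat P Q t0 t1 0 (2 * PI) Ht01 ltac:(lra)
  (fun x y Hx _ => Hdiff x y (proj2 Hx))) as HG.
unfold circulation in HG.
rewrite (RInt_ext (fun x => P x (2 * PI)) (fun x => P x 0)) in HG
  by (intros x _; unfold P; rewrite cos_2PI, sin_2PI, cos_0, sin_0; auto).
assert (Hex : forall t, t <= t1 -> ex_RInt (fun s => Q t s) 0 (2 * PI)).
{ intros t Ht. apply (ex_RInt_continuous (V := R_CompleteNormedModule)). intros s _.
  destruct (Hdiff t s Ht) as (p1 & p2 & q2 & _ & DQ).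
  apply (differentiable_continuous_slice (fun s t => Q t s) s t q2 p2).
  apply differentiable_swap, DQ. }
assert (H1 : RInt (fun s => Q t1 s) 0 (2 * PI) <= - (eps * (r / 2) ^ 2) * (2 * PI)).
{ replace (- (eps * (r / 2) ^ 2) * (2 * PI))
    with (RInt (fun _ => - (eps * (r / 2) ^ 2)) 0 (2 * PI)).
  2:{ rewrite RInt_const. unfold scal; simpl; unfold mult; simpl; ring. }
  apply RInt_le; auto; try lra; [apply Hex; lra|apply ex_RInt_const|].
  intros s _. unfold Q. eapply Rle_trans; [apply Hneg|]; rewrite Cmod_polar, Ht1; lra. }
assert (H0 : - eta * (2 * PI) <= RInt (fun s => Q t0 s) 0 (2 * PI)).
{ replace (- eta * (2 * PI)) with (RInt (fun _ => - eta) 0 (2 * PI)).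
  2:{ rewrite RInt_const. unfold scal; simpl; unfold mult; simpl; ring. }
  apply RInt_le; auto; try lra; [apply ex_RInt_const|].
  intros s _. unfold Q.
  pose proof (Hsmall (exp t0 * cos s, exp t0 * sin s)) as Hs.
  rewrite Cmod_polar in Hs. specialize (Hs Ht0).
  pose proof (re_le_Cmod (f (exp t0 * cos s, exp t0 * sin s))) as Hre.
  apply Rabs_le_between in Hre. lra. }
unfold eta in H0. nra.
Qed.

Ltac continuity_2d := repeat
  first [ apply continuity_2d_pt_const | apply continuity_2d_pt_plus
        | apply continuity_2d_pt_opp | apply continuity_2d_pt_minus
        | apply continuity_2d_pt_mult | apply continuity_2d_pt_id1
        | apply continuity_2d_pt_id2 ].

Lemma positive_nbhd (g : R -> R -> R) x y :
  continuity_2d_pt g x y -> 0 < g x y ->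
  exists d, 0 < d /\ forall u v, Rabs (u - x) < d -> Rabs (v - y) < d -> 0 < g u v.
Proof.
intros Hc Hg. destruct (Hc (mkposreal _ Hg)) as [d Hd].
exists d; split; [apply cond_pos|]. intros u v Hu Hv.
specialize (Hd u v Hu Hv). simpl in Hd. apply Rabs_lt_between in Hd. lra.
Qed.

(** Closed subsets of the complex plane. *)
Definition closed_plane (K : C -> Prop) : Prop :=
  forall x y, ~ K (x, y) -> exists d, 0 < d /\
    forall u v, Rabs (u - x) < d -> Rabs (v - y) < d -> ~ K (u, v).

(** Maximum principle for the real part of a complex differentiable function
    on a compact set.  If Re f had a positive maximum, then Re f + eps |z|^2
    would for some eps > 0 be maximal at an interior point z1, and
    f (z1 + h) - f (z1) + 2 eps conj(z1) h would have a strict maximum of the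
    excluded kind at h = 0. *)
Lemma maximum_principle (f : C -> C) (K : C -> Prop) (M : R) :
  (forall z, K z -> Cmod z <= M) -> closed_plane K ->
  (forall z, K z -> exists l, cdiff f z l) ->
  (forall z, K z -> Re (f z) <= 0 \/
     exists r, 0 < r /\ forall h, Cmod h < r -> K (z + h)%C) ->
  forall z, K z -> Re (f z) <= 0.
Proof.
intros HM Hcl Hf Hbd z0 Hz0.
apply Rnot_lt_le; intros Hpos.
set (eps := Re (f z0) / (2 * (M ^ 2 + 1))).
assert (HM2 : 0 < M ^ 2 + 1) by (pose proof (pow2_ge_0 M); lra).
assert (Heps : 0 < eps) by (apply Rdiv_lt_0_compat; lra).
destruct (plane_maximum (fun x y => Re (f (x, y)) + eps * Cmod (x, y) ^ 2)
  (fun x y => K (x, y)) M) as (x1 & y1 & Hz1 & Hmax).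
- intros x y Hxy. specialize (HM _ Hxy).
  pose proof (re_le_Cmod (x, y)). pose proof (im_le_Cmod (x, y)). simpl in *. lra.
- exact Hcl.
- intros x y Hxy e He.
  destruct (Hf _ Hxy) as [l Hl]. destruct (cdiff_lipschitz _ _ _ Hl) as (d & Hd & Hlip).
  set (z := (x, y)) in *.
  set (A := Cmod l + 1 + eps * (2 * Cmod z + 1)).
  pose proof (Cmod_ge_0 l). pose proof (Cmod_ge_0 z).
  assert (HA : 0 < A) by (unfold A; nra).
  exists (Rmin (Rmin d 1) (e / A) / 2). split.
  { assert (0 < Rmin (Rmin d 1) (e / A)); [|lra].
    repeat apply Rmin_pos; try lra. apply Rdiv_lt_0_compat; auto. }
  intros x' y' _ Hx' Hy'.
  set (h := (x' - x, y' - y) : C).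
  assert (Hh : Cmod h < Rmin (Rmin d 1) (e / A)).
  { pose proof (Cmod_le_2Rmax h) as Hm. unfold h in Hm; simpl in Hm; fold h in Hm.
    pose proof (Rmax_lub_lt _ _ _ Hx' Hy'). lra. }
  pose proof (Rlt_le_trans _ _ _ Hh (Rmin_l _ _)) as Hh1.
  pose proof (Rlt_le_trans _ _ _ Hh (Rmin_r _ _)) as Hh2.
  pose proof (Rlt_le_trans _ _ _ Hh1 (Rmin_l _ _)) as Hh3.
  pose proof (Rlt_le_trans _ _ _ Hh1 (Rmin_r _ _)) as Hh4.
  replace (x', y') with (z + h)%C
    by (unfold z, h, Cplus; simpl; f_equal; ring).
  specialize (Hlip h Hh3).
  assert (HR : Re (f (z + h)%C) <= Re (f z) + (Cmod l + 1) * Cmod h).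
  { pose proof (re_le_Cmod (f (z + h) - f z)%C) as Hre.
    unfold Cminus in Hre, Hlip. rewrite re_plus, re_opp in Hre.
    apply Rabs_le_between in Hre. lra. }
  pose proof (Cmod_triangle z h) as Ht. pose proof (Cmod_ge_0 (z + h)%C).
  pose proof (Cmod_ge_0 h).
  assert (Hsq : Cmod (z + h)%C ^ 2 <= Cmod z ^ 2 + (2 * Cmod z + 1) * Cmod h) by nra.
  assert (HAh : A * Cmod h < e).
  { apply Rlt_div_r in Hh2; auto. lra. }
  unfold A in HAh. nra.
- exists (Re z0), (Im z0). rewrite <- surjective_pairing. exact Hz0.
- set (z1 := (x1, y1)) in *.
  assert (Hpos1 : 0 < Re (f z1)).
  { specialize (Hmax (Re z0) (Im z0)). rewrite <- surjective_pairing in Hmax.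
    specialize (Hmax Hz0).
    pose proof (Cmod_ge_0 z0). pose proof (HM _ Hz1). pose proof (Cmod_ge_0 z1).
    assert (Cmod z1 ^ 2 <= M ^ 2) by nra.
    assert (E : Re (f z0) = eps * (2 * (M ^ 2 + 1))) by (unfold eps; field; lra).
    nra. }
  destruct (Hbd _ Hz1) as [Hle|(r & Hr & HK)]; [lra|].
  apply (no_strict_maximum
    (fun h => f (z1 + h) + (- f z1 + (2 * eps * Cconj z1)%C * h + 0 * h * h))%C r eps); auto.
  + intros h Hh. destruct (Hf _ (HK h Hh)) as [l Hl].
    eexists. apply cdiff_plus; [apply cdiff_translate; exact Hl|apply cdiff_quadratic].
  + rewrite Cplus_0_r. ring.
  + intros h Hh. pose proof (HK h Hh) as Hk.
    specialize (Hmax (fst (z1 + h)%C) (snd (z1 + h)%C)).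
    rewrite <- surjective_pairing in Hmax. specialize (Hmax Hk).
    rewrite !Cmod2_alt in *.
    rewrite !re_plus, re_opp in *.
    unfold Re, Im in *; simpl in *. lra.
Qed.

Lemma sqr_le_Cmod (z : C) r : 0 <= r -> (Cmod z <= r <-> Re z * Re z + Im z * Im z <= r * r).
Proof.
intros Hr. pose proof (Cmod2_alt z). pose proof (Cmod_ge_0 z). simpl in H.
rewrite !Rmult_1_r in H. rewrite <- H.
split; intros; nra.
Qed.

Lemma disc_maximum (f : C -> C) :
  (forall z, Cmod z <= 1 -> exists l, cdiff f z l) ->
  (forall z, Cmod z = 1 -> Re (f z) <= 0) ->
  forall z, Cmod z <= 1 -> Re (f z) <= 0.
Proof.
intros Hf Hb. apply (maximum_principle f (fun z => Cmod z <= 1) 1); auto.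
- intros x y Hxy.
  destruct (positive_nbhd (fun x y => x * x + y * y - 1) x y) as (d & Hd & Hd').
  + continuity_2d.
  + rewrite sqr_le_Cmod in Hxy by lra. simpl in Hxy. lra.
  + exists d; split; auto. intros u v Hu Hv. rewrite sqr_le_Cmod by lra; simpl.
    specialize (Hd' u v Hu Hv). lra.
- intros z [Hz|Hz]; [|left; auto].
  right. exists (1 - Cmod z). split; [lra|]. intros h Hh.
  eapply Rle_trans; [apply Cmod_triangle|lra].
Qed.

(** The Cauchy-Riemann equations show that the derivative of a real-valued
    function vanishes. *)
Lemma real_valued_constant (f : C -> C) :
  (forall z, Cmod z < 1 -> exists l, cdiff f z l) ->
  (forall z, Cmod z < 1 -> Im (f z) = 0) ->
  forall z, Cmod z < 1 -> f z = f 0.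
Proof.
intros Hf HI.
assert (H0 : forall z, Cmod z < 1 -> cdiff f z 0).
{ intros z Hz. destruct (Hf z Hz) as [l Hl].
  replace (RtoC 0) with l; auto.
  destruct z as [x y].
  destruct (cdiff_real_parts _ _ _ _ Hl) as [_ HD].
  destruct (differentiable_pt_lim_unique _ _ _ _ _ HD) as [D1 D2].
  destruct (positive_nbhd (fun x y => 1 - (x * x + y * y)) x y) as (d & Hd & Hd').
  { continuity_2d. }
  { pose proof (Cmod2_alt (x, y)) as Hsq. simpl in Hsq. pose proof (Cmod_ge_0 (x, y)). nra. }
  assert (HZ : forall u v, Rabs (u - x) < d -> Rabs (v - y) < d -> Im (f (u, v)) = 0).
  { intros u v Hu Hv. apply HI. specialize (Hd' u v Hu Hv).
    pose proof (Cmod2_alt (u, v)) as Hsq. simpl in Hsq. pose proof (Cmod_ge_0 (u, v)). nra. }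
  assert (Hxx : forall x, Rabs (x - x) < d)
    by (intros x'; rewrite Rminus_diag_eq, Rabs_R0; auto).
  rewrite (surjective_pairing l). unfold RtoC. f_equal.
  - change (Re l = 0). rewrite <- D2. rewrite (Derive_ext_loc _ (fun _ => 0)).
    + apply Derive_const.
    + exists (mkposreal d Hd). intros v Hv. apply HZ; auto.
  - change (Im l = 0). rewrite <- D1. rewrite (Derive_ext_loc _ (fun _ => 0)).
    + apply Derive_const.
    + exists (mkposreal d Hd). intros u Hu. apply HZ; auto. }
intros z Hz.
assert (HR : Re (f (0%R * z)%C) = Re (f (1%R * z)%C)).
{ apply (eq_is_derive (V := R_NormedModule) (fun t : R => Re (f (t * z)%C)) 0 1); [|lra].
  intros t Ht. change (is_derive (fun t : R => Re (f (t * z)%C)) t 0).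
  rewrite is_derive_Reals. intros eps He.
  pose proof (Cmod_ge_0 z) as Hz0.
  assert (Htz : Cmod (t * z)%C < 1).
  { rewrite Cmod_mult, Cmod_R, Rabs_pos_eq by lra. nra. }
  destruct (H0 _ Htz (eps / 2) ltac:(lra)) as (d & Hd & Hlin).
  exists (mkposreal d Hd). intros s Hs Hsd. simpl in Hsd.
  assert (Hs' : 0 < Rabs s) by (apply Rabs_pos_lt; auto).
  assert (Hsz : Cmod (s * z)%C <= Rabs s) by (rewrite Cmod_mult, Cmod_R; nra).
  specialize (Hlin (s * z)%C ltac:(lra)).
  rewrite <- Cmult_plus_distr_r, <- RtoC_plus, Cmult_0_l in Hlin.
  rewrite Rminus_0_r. unfold Rdiv. rewrite Rabs_mult, Rabs_inv.
  apply Rmult_lt_reg_r with (Rabs s); auto.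
  rewrite Rmult_assoc, Rinv_l, Rmult_1_r by lra.
  pose proof (re_le_Cmod (f ((t + s)%R * z) - f (t * z) - 0)%C) as Hre.
  unfold Cminus in Hre. rewrite !re_plus, !re_opp in Hre. simpl (Re 0) in Hre.
  unfold Cminus in Hlin.
  replace (Re (f ((t + s)%R * z)%C) - Re (f (t * z)%C))
    with (Re (f ((t + s)%R * z)%C) + - Re (f (t * z)%C) + - 0) by ring.
  eapply Rle_lt_trans; [exact Hre|]. eapply Rle_lt_trans; [exact Hlin|]. nra. }
rewrite Cmult_0_l, Cmult_1_l in HR.
rewrite (surjective_pairing (f z)), (surjective_pairing (f 0)).
f_equal; [symmetry; exact HR|].
change (Im (f z) = Im (f 0)). rewrite !HI; auto. rewrite Cmod_0; lra.
Qed.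

(** * Boundary behaviour on the unit disc *)

(** Hopf boundary lemma at the point 1 of the unit disc.  With 1 - z = x + i y,
    the barrier (1 - z) + (1 - z)^2 has real part x + x^2 - y^2.  The region
    where this is nonnegative and 0 <= x <= eta lies in the open disc except
    for the point 1.  On it Re G + kappa (x + x^2 - y^2) is at most 0 for a
    small kappa > 0, by the maximum principle. *)
Lemma hopf_boundary (G : C -> C) (delta : R) (l : C) :
  0 < delta ->
  (forall z, Cmod z <= 1 -> Cmod (z - 1)%C < delta -> exists l, cdiff G z l) ->
  G 1 = 0 -> cdiff G 1 l ->
  (forall z, Cmod z < 1 -> Cmod (z - 1)%C < delta -> Re (G z) < 0) ->
  0 < Re l.
Proof.
intros Hdelta HG HG1 Hl Hneg.
set (eta := Rmin (1 / 4) (delta ^ 2 / 2)).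
assert (Hd2 : 0 < delta ^ 2) by (apply pow_lt; auto).
assert (Heta : 0 < eta) by (apply Rmin_pos; lra).
assert (He1 : eta <= 1 / 4) by apply Rmin_l.
assert (He2 : eta <= delta ^ 2 / 2) by apply Rmin_r.
(* The bound 2 eta^2 + eta < delta^2 keeps the region within distance delta of 1. *)
set (K := fun z : C => 1 - eta <= Re z <= 1 /\
  0 <= (1 - Re z) + (1 - Re z) * (1 - Re z) - Im z * Im z).
assert (HKd : forall z, K z -> Cmod z <= 1 /\ Cmod (z - 1)%C < delta /\
  (Re z < 1 -> Cmod z < 1)).
{ intros z [Hx Hy].
  assert (Hsq : Cmod z ^ 2 = Re z ^ 2 + Im z ^ 2) by apply Cmod2_alt.
  assert (Hsq1 : Cmod (z - 1)%C ^ 2 = (Re z - 1) ^ 2 + Im z ^ 2).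
  { rewrite Cmod2_alt. unfold Re, Im; simpl. ring. }
  pose proof (Cmod_ge_0 z). pose proof (Cmod_ge_0 (z - 1)%C).
  repeat split; [nra|nra|intros Hx1; nra]. }
assert (HKcl : closed_plane K).
{ intros x y Hxy.
  assert (Hc : 0 < 1 - eta - x \/ 0 < x - 1 \/
    0 < y * y - ((1 - x) + (1 - x) * (1 - x))).
  { apply NNPP; intros Hn. apply Hxy. unfold K; simpl. lra. }
  destruct Hc as [Hc|[Hc|Hc]];
  [ destruct (positive_nbhd (fun x y => 1 - eta - x) x y) as (d & Hd & Hd')
  | destruct (positive_nbhd (fun x y => x - 1) x y) as (d & Hd & Hd')
  | destruct (positive_nbhd (fun x y => y * y - ((1 - x) + (1 - x) * (1 - x))) x y)
      as (d & Hd & Hd')]; try (exact Hc); try (continuity_2d; fail);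
  exists d; split; auto; intros u v Hu Hv [Hx Hy]; specialize (Hd' u v Hu Hv);
  simpl in *; lra. }
(* On the inner edge of the region, Re G is bounded away from 0. *)
assert (Hm : exists m, 0 < m /\ forall z, K z -> Re z = 1 - eta -> Re (G z) <= - m).
{ destruct (plane_maximum (fun x y => Re (G (x, y)))
    (fun x y => K (x, y) /\ x = 1 - eta) 1) as (x1 & y1 & [HK1 Hx1] & Hmax).
  - intros x y [HK _]. destruct (HKd _ HK) as [H1 _].
    pose proof (re_le_Cmod (x, y)). pose proof (im_le_Cmod (x, y)). simpl in *. lra.
  - intros x y Hxy. destruct (classic (K (x, y))) as [HK|HK].
    + assert (Hx : x <> 1 - eta) by tauto.
      exists (Rabs (x - (1 - eta))). split; [apply Rabs_pos_lt; lra|].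
      intros x' y' Hx' _ [_ E]. subst x'. rewrite Rabs_minus_sym in Hx'. lra.
    + destruct (HKcl _ _ HK) as (d & Hd & Hd'). exists d; split; auto.
      intros u v Hu Hv [HK' _]. apply (Hd' u v); auto.
  - intros x y [HK _] e He. destruct (HKd _ HK) as (H1 & H2 & _).
    destruct (HG _ H1 H2) as [l' Hl'].
    destruct (cdiff_lipschitz _ _ _ Hl') as (d & Hd & Hlip).
    pose proof (Cmod_ge_0 l').
    exists (Rmin d (e / (Cmod l' + 1)) / 2). split.
    { assert (0 < Rmin d (e / (Cmod l' + 1))); [|lra].
      apply Rmin_pos; auto. apply Rdiv_lt_0_compat; lra. }
    intros x' y' _ Hx' Hy'.
    set (h := (x' - x, y' - y) : C).
    assert (Hh : Cmod h < Rmin d (e / (Cmod l' + 1))).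
    { pose proof (Cmod_le_2Rmax h) as Hm. unfold h in Hm; simpl in Hm; fold h in Hm.
      pose proof (Rmax_lub_lt _ _ _ Hx' Hy'). lra. }
    pose proof (Rlt_le_trans _ _ _ Hh (Rmin_l _ _)) as Hh1.
    pose proof (Rlt_le_trans _ _ _ Hh (Rmin_r _ _)) as Hh2.
    specialize (Hlip h Hh1).
    replace ((x, y) + h)%C with ((x', y') : C) in Hlip
      by (unfold h, Cplus; simpl; f_equal; ring).
    pose proof (re_le_Cmod (G (x', y') - G (x, y))%C) as Hre.
    unfold Cminus in Hre, Hlip. rewrite re_plus, re_opp in Hre.
    apply Rabs_le_between in Hre. apply Rlt_div_r in Hh2; [|lra]. lra.
  - exists (1 - eta), 0. unfold K; simpl. repeat split; nra.
  - exists (- Re (G (x1, y1))). split.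
    + destruct (HKd _ HK1) as (_ & H2 & H3).
      specialize (Hneg _ (H3 ltac:(simpl; lra)) H2). lra.
    + intros z Hz Hz1. specialize (Hmax (Re z) (Im z)).
      rewrite <- surjective_pairing in Hmax. specialize (Hmax (conj Hz Hz1)). lra. }
destruct Hm as (m & Hm & Hedge).
set (kappa := m / (eta + eta * eta)).
assert (Hden : 0 < eta + eta * eta) by nra.
assert (Hkappa : 0 < kappa) by (apply Rdiv_lt_0_compat; auto).
assert (HGneg : forall z, K z -> Re (G z) <= 0).
{ intros z Hz. destruct (HKd z Hz) as (H1 & H2 & H3).
  destruct Hz as [[_ Hx] Hy]. destruct Hx as [Hx|Hx].
  - apply Rlt_le, Hneg; auto.
  - replace z with (RtoC 1); [rewrite HG1; apply Rle_refl|].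
    rewrite Hx in Hy. assert (Im z = 0) by nra.
    rewrite (surjective_pairing z). unfold Re, Im, RtoC in *. f_equal; auto. }
(* The polynomial 2 - 3 z + z^2 is the barrier (1 - z) + (1 - z)^2. *)
assert (HB : forall z, K z ->
  Re (G z + (2 * kappa + (- 3 * kappa)%R * z + kappa * z * z))%C <= 0).
{ assert (ReB : forall z, Re (2 * kappa + (- 3 * kappa)%R * z + kappa * z * z)%C =
    kappa * ((1 - Re z) + (1 - Re z) * (1 - Re z) - Im z * Im z)).
  { intros z. unfold Re, Im; simpl. ring. }
  apply (maximum_principle _ K 1); auto.
  - intros z Hz; apply HKd, Hz.
  - intros z Hz. destruct (HKd z Hz) as (H1 & H2 & _). destruct (HG z H1 H2) as [l' Hl'].
    eexists. apply cdiff_plus; [exact Hl'|apply cdiff_quadratic].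
  - intros z Hz. pose proof Hz as [[Hx1 Hx2] Hy].
    rewrite re_plus, ReB. pose proof (HGneg z Hz) as Hz0.
    destruct Hy as [Hy|Hy]; [|left; rewrite <- Hy; lra].
    destruct Hx1 as [Hx1|Hx1].
    + right.
      assert (Hx3 : Re z < 1) by nra.
      set (x := Re z) in *. set (y := Im z) in *.
      destruct (positive_nbhd (fun x y => x - (1 - eta)) x y) as (d1 & Hd1 & Hd1');
        [continuity_2d|lra|].
      destruct (positive_nbhd (fun x y => 1 - x) x y) as (d2 & Hd2' & Hd2'');
        [continuity_2d|lra|].
      destruct (positive_nbhd (fun x y => (1 - x) + (1 - x) * (1 - x) - y * y) x y)
        as (d3 & Hd3 & Hd3'); [continuity_2d|lra|].
      exists (Rmin d1 (Rmin d2 d3)). split; [repeat apply Rmin_pos; auto|].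
      intros h Hh.
      pose proof (Rmin_l d1 (Rmin d2 d3)). pose proof (Rmin_r d1 (Rmin d2 d3)).
      pose proof (Rmin_l d2 d3). pose proof (Rmin_r d2 d3).
      pose proof (re_le_Cmod h). pose proof (im_le_Cmod h).
      assert (E1 : Re (z + h)%C - x = Re h) by (rewrite re_plus; unfold x; ring).
      assert (E2 : Im (z + h)%C - y = Im h) by (unfold y, Im; simpl; ring).
      assert (F1 : Rabs (Re (z + h)%C - x) < d1) by (rewrite E1; lra).
      assert (F1' : Rabs (Im (z + h)%C - y) < d1) by (rewrite E2; lra).
      assert (F2 : Rabs (Re (z + h)%C - x) < d2) by (rewrite E1; lra).
      assert (F2' : Rabs (Im (z + h)%C - y) < d2) by (rewrite E2; lra).
      assert (F3 : Rabs (Re (z + h)%C - x) < d3) by (rewrite E1; lra).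
      assert (F3' : Rabs (Im (z + h)%C - y) < d3) by (rewrite E2; lra).
      specialize (Hd1' _ _ F1 F1'). specialize (Hd2'' _ _ F2 F2').
      specialize (Hd3' _ _ F3 F3'). unfold K. lra.
    + left. pose proof (Hedge z Hz (eq_sym Hx1)).
      rewrite <- Hx1.
      assert (kappa * (eta + eta * eta) = m) by (unfold kappa; field; lra).
      assert (0 <= Im z * Im z) by nra. nra. }
destruct (Hl (kappa / 2) ltac:(lra)) as (d & Hd & Hlin).
set (x := Rmin (d / 2) eta).
assert (Hx : 0 < x) by (apply Rmin_pos; lra).
assert (Hxd : x < d) by (pose proof (Rmin_l (d / 2) eta); unfold x; lra).
assert (Hxe : x <= eta) by apply Rmin_r.
specialize (HB (1 - x)%R).
assert (HKx : K (1 - x)%R) by (unfold K; simpl; repeat split; nra).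
specialize (HB HKx).
specialize (Hlin (RtoC (- x))). rewrite Cmod_R, Rabs_Ropp, Rabs_pos_eq in Hlin by lra.
specialize (Hlin Hxd).
replace (1 + (- x)%R)%C with (RtoC (1 - x)) in Hlin by (rewrite <- RtoC_plus; f_equal; ring).
rewrite HG1 in Hlin.
pose proof (re_le_Cmod (G (1 - x)%R - 0 - l * (- x)%R)%C) as Hre.
apply Rabs_le_between in Hre.
unfold Re, Im in *; simpl in *. nra.
Qed.

(** If the maximum of Re G over the closed disc near 1 is attained at 1, then
    the derivative at 1 is a nonnegative real number. *)
Lemma boundary_maximum_derivative (G : C -> C) (delta : R) (l : C) :
  0 < delta -> cdiff G 1 l -> G 1 = 0 ->
  (forall z, Cmod z <= 1 -> Cmod (z - 1)%C < delta -> Re (G z) <= 0) ->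
  Im l = 0 /\ 0 <= Re l.
Proof.
intros Hd Hl H1 Hneg.
(* For b > 0 the direction - b + i y points into the disc, so that 1 + s (- b + i y)
   is in it for small s > 0.  Letting b tend to 0 gives the tangential directions. *)
assert (Key : forall (b : R) eps, 0 < eps -> 0 < b ->
  forall y, Rabs y <= 1 -> Re (l * ((- b)%R, y))%C <= eps * 2 * (b + 1)).
{ intros b eps He Hb y Hy.
  destruct (Hl eps He) as (d & Hdd & Hlin).
  set (s := Rmin (Rmin (/ 2) (2 * b / ((b + 1) ^ 2))) (Rmin d delta / (4 * (b + 1)))).
  assert (Hbb : 0 < (b + 1) ^ 2) by (apply pow_lt; lra).
  assert (Hs : 0 < s).
  { repeat apply Rmin_pos; try lra; apply Rdiv_lt_0_compat; try lra.
    apply Rmin_pos; auto. }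
  assert (Hs1 : s * (b + 1) ^ 2 <= 2 * b).
  { apply Rle_div_r; auto. eapply Rle_trans; [apply Rmin_l|apply Rmin_r]. }
  assert (Hs2 : s * (4 * (b + 1)) <= Rmin d delta).
  { apply Rle_div_r; [lra|]. apply Rmin_r. }
  pose proof (Rmin_l d delta). pose proof (Rmin_r d delta).
  set (h := (s * - b, s * y) : C).
  assert (Hh : Cmod h <= s * (2 * (b + 1))).
  { eapply Rle_trans; [apply Cmod_le_2Rmax|]. unfold h; simpl.
    assert (Rmax (Rabs (s * - b)) (Rabs (s * y)) <= s * (b + 1)); [|lra].
    rewrite !Rabs_mult, Rabs_Ropp, !(Rabs_pos_eq s), (Rabs_pos_eq b) by lra.
    apply Rmax_lub; apply Rmult_le_compat_l; lra. }
  assert (Hsb : 0 < s * (b + 1)) by (apply Rmult_lt_0_compat; lra).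
  assert (Hin : Cmod (1 + h)%C <= 1).
  { apply sqr_le_Cmod; [lra|]. unfold h; simpl.
    apply Rabs_le_between in Hy.
    assert (y * y <= 1) by nra.
    assert (s * (b * b + y * y) <= s * (b + 1) ^ 2) by (apply Rmult_le_compat_l; nra).
    nra. }
  specialize (Hneg (1 + h)%C Hin).
  replace (1 + h - 1)%C with h in Hneg by ring.
  specialize (Hneg ltac:(lra)). specialize (Hlin h ltac:(lra)).
  rewrite H1 in Hlin.
  assert (Hgoal : s * Re (l * ((- b)%R, y))%C <= s * (eps * 2 * (b + 1))).
  { replace (s * Re (l * ((- b)%R, y))%C) with (Re (l * h)%C) by (unfold h, Re, Im; simpl; ring).
    pose proof (re_le_Cmod (G (1 + h) - 0 - l * h)%C) as Hre.
    unfold Cminus in Hre, Hlin. rewrite !re_plus, !re_opp in Hre.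
    apply Rabs_le_between in Hre. simpl (Re 0) in Hre.
    assert (eps * Cmod h <= eps * (s * (2 * (b + 1)))) by (apply Rmult_le_compat_l; lra).
    lra. }
  apply Rmult_le_reg_l in Hgoal; auto. }
assert (Lim : forall A B, 0 <= B -> (forall eps, 0 < eps -> A <= eps * B) -> A <= 0).
{ intros A B HB HA. apply Rnot_lt_le; intros Hlt.
  specialize (HA (A / (2 * (B + 1)))).
  assert (0 < A / (2 * (B + 1))) by (apply Rdiv_lt_0_compat; lra).
  specialize (HA H).
  assert (A / (2 * (B + 1)) * B <= A / 2).
  { replace (A / (2 * (B + 1)) * B) with (A / 2 * (B / (B + 1))) by (field; lra).
    assert (B / (B + 1) <= 1) by (apply Rle_div_l; lra). nra. }
  lra. }
assert (Key2 : forall b y, 0 < b -> Rabs y <= 1 -> - b * Re l - y * Im l <= 0).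
{ intros b y Hb Hy. apply Lim with (2 * (b + 1)); [lra|]. intros eps He.
  specialize (Key b eps He Hb y Hy). rewrite re_mult in Key. simpl in Key. lra. }
assert (HR : 0 <= Re l).
{ specialize (Key2 1 0 ltac:(lra)). rewrite Rabs_R0 in Key2. specialize (Key2 ltac:(lra)). lra. }
split; auto.
assert (HI : forall y, Rabs y <= 1 -> - y * Im l <= 0).
{ intros y Hy. apply Lim with (Re l); auto. intros eps He.
  specialize (Key2 eps y He Hy). lra. }
assert (A1 : Rabs 1 <= 1) by (rewrite Rabs_R1; lra).
assert (A2 : Rabs (-1) <= 1) by (rewrite Rabs_left; lra).
pose proof (HI 1 A1). pose proof (HI (-1) A2). lra.
Qed.

(** * Expansions of differentiable functions on C^2 *)

Definition add2 (p h : C2) : C2 := (Cplus (fst p) (fst h), Cplus (snd p) (snd h)).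

Definition sub2 (p q : C2) : C2 := (Cminus (fst p) (fst q), Cminus (snd p) (snd q)).

Lemma add2_sub2 (q x : C2) : add2 q (sub2 x q) = x.
Proof.
unfold add2, sub2; simpl. rewrite (surjective_pairing x) at 3. f_equal; ring.
Qed.

(** The sum norm on C^2, to which the norms of C^2 as a real and as a complex
    normed space are compared. *)
Definition norm2 (h : C2) : R := Cmod (fst h) + Cmod (snd h).

Lemma norm2_ge_0 h : 0 <= norm2 h.
Proof. unfold norm2. pose proof (Cmod_ge_0 (fst h)). pose proof (Cmod_ge_0 (snd h)). lra. Qed.

Lemma norm2_scal2 (c : C) v : norm2 (scal2 c v) = Cmod c * norm2 v.
Proof. unfold norm2; simpl. rewrite !Cmod_mult. ring. Qed.

Lemma coordinates_le_norm2 (h : C2) :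
  Rabs (Re (fst h)) <= norm2 h /\ Rabs (Im (fst h)) <= norm2 h /\
  Rabs (Re (snd h)) <= norm2 h /\ Rabs (Im (snd h)) <= norm2 h.
Proof.
pose proof (re_le_Cmod (fst h)). pose proof (im_le_Cmod (fst h)).
pose proof (re_le_Cmod (snd h)). pose proof (im_le_Cmod (snd h)).
pose proof (Cmod_ge_0 (fst h)). pose proof (Cmod_ge_0 (snd h)).
unfold norm2. lra.
Qed.

Lemma open_norm2 (U : C2 -> Prop) p :
  open U -> U p -> exists d, 0 < d /\ forall h, norm2 h < d -> U (add2 p h).
Proof.
intros HU Hp. destruct (HU p Hp) as [d Hd].
exists d; split; [apply cond_pos|]. intros h Hh. apply Hd.
assert (B : forall (z w : C), Cmod w < d -> ball z d (z + w)%C).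
{ intros z w Hw. split.
  - change (Rabs ((fst z + fst w) + - fst z) < d).
    replace (fst z + fst w + - fst z) with (fst w) by ring.
    eapply Rle_lt_trans; [apply re_le_Cmod|auto].
  - change (Rabs ((snd z + snd w) + - snd z) < d).
    replace (snd z + snd w + - snd z) with (snd w) by ring.
    eapply Rle_lt_trans; [apply im_le_Cmod|auto]. }
unfold norm2 in Hh. pose proof (Cmod_ge_0 (fst h)). pose proof (Cmod_ge_0 (snd h)).
split; simpl; apply B; lra.
Qed.

Lemma minus_plus_cancel {G : AbelianGroup} (x h : G) : minus (plus x h) x = h.
Proof.
unfold minus. rewrite (plus_comm x h), <- plus_assoc.
eapply eq_trans; [apply (f_equal (plus h)), plus_opp_r|apply plus_zero_r].
Qed.

Lemma filterdiff_eps {K : AbsRing} {U V : NormedModule K} (f : U -> V) (x : U) (L : U -> V) :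
  filterdiff f (locally x) L ->
  forall eps, 0 < eps -> exists delta, 0 < delta /\ forall h, norm h < delta ->
    norm (minus (minus (f (plus x h)) (f x)) (L h)) <= eps * norm h.
Proof.
intros [_ H] eps He.
destruct (H x (fun P HP => HP) (mkposreal eps He)) as [d Hd].
exists d; split; [apply cond_pos|]. intros h Hh.
assert (E : minus (plus x h) x = h) by exact (minus_plus_cancel x h).
specialize (Hd (plus x h)). rewrite E in Hd. apply Hd.
apply norm_compat1. rewrite E. exact Hh.
Qed.

Lemma norm_C_R (z : C) : norm (V := C_R_NormedModule) z = Cmod z.
Proof.
unfold Cmod. change (norm (V := C_R_NormedModule) z) with
  (sqrt (Rabs (fst z) ^ 2 + Rabs (snd z) ^ 2)).
rewrite !pow2_abs. reflexivity.
Qed.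

Lemma sqrt_sqr_plus_le a b : 0 <= a -> 0 <= b -> sqrt (a ^ 2 + b ^ 2) <= a + b.
Proof.
intros Ha Hb. apply Rle_trans with (sqrt ((a + b) * (a + b))).
- apply sqrt_le_1_alt. nra.
- rewrite sqrt_square; lra.
Qed.

Lemma norm_C2_R_le (h : C2) : norm (V := C2_R) h <= norm2 h.
Proof.
unfold norm2. rewrite <- !norm_C_R. apply sqrt_sqr_plus_le; apply norm_ge_0.
Qed.

Lemma norm_C2_le (h : C2) :
  norm (V := prod_NormedModule C_AbsRing C_NormedModule C_NormedModule) h <= norm2 h.
Proof. apply (sqrt_sqr_plus_le (Cmod (fst h)) (Cmod (snd h))); apply Cmod_ge_0. Qed.

Lemma norm2_le_2sqrt (h : C2) : norm2 h <= 2 * sqrt (Cmod (fst h) ^ 2 + Cmod (snd h) ^ 2).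
Proof.
unfold norm2. set (a := Cmod (fst h)). set (b := Cmod (snd h)).
assert (Ha : a <= sqrt (a ^ 2 + b ^ 2)).
{ rewrite <- (sqrt_pow2 a) at 1 by apply Cmod_ge_0. apply sqrt_le_1_alt.
  pose proof (pow2_ge_0 b); lra. }
assert (Hb : b <= sqrt (a ^ 2 + b ^ 2)).
{ rewrite <- (sqrt_pow2 b) at 1 by apply Cmod_ge_0. apply sqrt_le_1_alt.
  pose proof (pow2_ge_0 a); lra. }
lra.
Qed.

Lemma norm_C2_R_ge (h : C2) : norm2 h <= 2 * norm (V := C2_R) h.
Proof.
eapply Rle_trans; [apply norm2_le_2sqrt|].
rewrite <- !norm_C_R. apply Rle_refl.
Qed.

(** With e1 and e2, the vectors f1 = i e1 and f2 = i e2 form the real basis of C^2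
    used for the coordinates. *)
Definition f1 : C2 := scal2 Ci e1.

Definition f2 : C2 := scal2 Ci e2.

Lemma translate_add2 p t v : translate p t v = add2 p (scal2 t v).
Proof. reflexivity. Qed.

Lemma translate_translate x t s h :
  translate (translate x t h) s h = translate x (t + s) h.
Proof.
unfold translate; simpl. rewrite RtoC_plus. f_equal; ring.
Qed.

(** Real differentiability gives the first-order expansion in terms of the
    directional derivatives, which are real linear in the direction. *)
Lemma real_differentiable (rho : C2 -> R) (x : C2) :
  ex_filterdiff (U := C2_R) rho (locally x) ->
  (forall eps, 0 < eps -> exists delta, 0 < delta /\ forall h, norm2 h < delta ->
     Rabs (rho (add2 x h) - rho x - dirder rho h x) <= eps * norm2 h) /\
  (forall h, is_derive (fun t => rho (translate x t h)) 0 (dirder rho h x)) /\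
  (forall h, dirder rho h x =
     Re (fst h) * dirder rho e1 x + Im (fst h) * dirder rho f1 x +
     Re (snd h) * dirder rho e2 x + Im (snd h) * dirder rho f2 x).
Proof.
intros [L HL].
assert (HE : forall eps, 0 < eps -> exists delta, 0 < delta /\ forall h, norm2 h < delta ->
     Rabs (rho (add2 x h) - rho x - L h) <= eps * norm2 h).
{ intros eps He. destruct (filterdiff_eps _ _ _ HL eps He) as (d & Hd & Hf).
  exists d; split; auto. intros h Hh.
  pose proof (norm_C2_R_le h) as Hn.
  eapply Rle_trans; [|apply Rmult_le_compat_l, Hn; lra].
  apply (Hf h). lra. }
destruct HL as [[Hplus0 Hscal0 _] _].
assert (Hplus : forall u v, L (add2 u v) = L u + L v) by exact Hplus0.
assert (Hscal : forall (t : R) v, L (scal2 t v) = t * L v).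
{ intros t v. rewrite <- (Hscal0 t v : L _ = t * L v). f_equal.
  unfold scal2, scal; simpl. unfold prod_scal, scal, Cmult; simpl.
  unfold prod_scal, scal; simpl. unfold mult; simpl.
  f_equal; f_equal; ring. }
assert (HD : forall h, is_derive (fun t => rho (translate x t h)) 0 (L h)).
{ intros h. rewrite is_derive_Reals. intros eps He.
  pose proof (norm2_ge_0 h) as Hh.
  destruct (HE (eps / (2 * (norm2 h + 1)))) as (d & Hd & Hf).
  { apply Rdiv_lt_0_compat; lra. }
  assert (Hd' : 0 < d / (norm2 h + 1)) by (apply Rdiv_lt_0_compat; lra).
  exists (mkposreal _ Hd'). simpl. intros t Ht Htd.
  assert (Ht' : 0 < Rabs t) by (apply Rabs_pos_lt; auto).
  apply Rlt_div_r in Htd; [|lra].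
  rewrite !translate_add2, Rplus_0_l.
  replace (add2 x (scal2 0%R h)) with x.
  2:{ unfold add2, scal2; simpl. rewrite !Cmult_0_l, !Cplus_0_r. apply surjective_pairing. }
  assert (Hn : norm2 (scal2 t h) = Rabs t * norm2 h) by (rewrite norm2_scal2, Cmod_R; auto).
  specialize (Hf (scal2 t h)). rewrite Hn, Hscal in Hf. specialize (Hf ltac:(nra)).
  replace ((rho (add2 x (scal2 t h)) - rho x) / t - L h)
    with ((rho (add2 x (scal2 t h)) - rho x - t * L h) / t) by (field; auto).
  unfold Rdiv at 1. rewrite Rabs_mult, Rabs_inv.
  apply Rmult_lt_reg_r with (Rabs t); auto.
  rewrite Rmult_assoc, Rinv_l, Rmult_1_r by lra.
  eapply Rle_lt_trans; [exact Hf|].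
  replace (eps / (2 * (norm2 h + 1)) * (Rabs t * norm2 h))
    with (norm2 h / (norm2 h + 1) * (eps * Rabs t / 2)) by (field; lra).
  assert (norm2 h / (norm2 h + 1) <= 1) by (apply Rle_div_l; lra).
  assert (0 < eps * Rabs t / 2) by nra. nra. }
assert (HdL : forall h, dirder rho h x = L h).
{ intros h. apply is_derive_unique, HD. }
split; [|split].
- intros eps He. destruct (HE eps He) as (d & Hd & Hf). exists d; split; auto.
  intros h Hh. rewrite HdL; auto.
- intros h. rewrite HdL; auto.
- intros h. rewrite !HdL, <- !Hscal, <- !Hplus. f_equal.
  destruct h as [[x1 y1] [x2 y2]].
  unfold add2, scal2, f1, f2, e1, e2, scal2, Cplus, Cmult; simpl.
  f_equal; f_equal; ring.
Qed.

(** The quadratic form of second derivatives, in the real basis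
    e1, f1, e2, f2.  The matrix is not assumed to be symmetric. *)
Definition hessian (rho : C2 -> R) (x h : C2) : R :=
  let B := fun u w => dirder (dirder rho u) w x in
  let row := fun u => Re (fst h) * B u e1 + Im (fst h) * B u f1 +
                      Re (snd h) * B u e2 + Im (snd h) * B u f2 in
  Re (fst h) * row e1 + Im (fst h) * row f1 + Re (snd h) * row e2 + Im (snd h) * row f2.

(** Second-order Taylor expansion: the mean value theorem on the segment from x
    to x + h, with the first derivatives expanded at x. *)
Lemma taylor2 (U : C2 -> Prop) (rho : C2 -> R) (x : C2) :
  open U -> U x -> Cn 2 U rho ->
  forall eps, 0 < eps -> exists delta, 0 < delta /\ forall h, norm2 h < delta ->
    U (add2 x h) /\
    Rabs (rho (add2 x h) - rho x - dirder rho h x - hessian rho x h / 2)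
      <= eps * norm2 h ^ 2.
Proof.
intros HU Hx [HC1 HC2] eps He.
assert (HB : forall v, exists delta, 0 < delta /\ forall h, norm2 h < delta ->
  Rabs (dirder rho v (add2 x h) - dirder rho v x - dirder (dirder rho v) h x)
    <= eps / 4 * norm2 h).
{ intros v. destruct (HC2 v) as [HC3 _].
  apply (real_differentiable _ _ (HC3 x Hx)). lra. }
destruct (HB e1) as (d1 & Hd1 & B1). destruct (HB f1) as (d2 & Hd2 & B2).
destruct (HB e2) as (d3 & Hd3 & B3). destruct (HB f2) as (d4 & Hd4 & B4).
destruct (open_norm2 U x HU Hx) as (d0 & Hd0 & B0).
exists (Rmin d0 (Rmin (Rmin d1 d2) (Rmin d3 d4))).
split; [repeat apply Rmin_pos; auto|].
intros h Hh.
assert (HH : norm2 h < d0 /\ norm2 h < d1 /\ norm2 h < d2 /\ norm2 h < d3 /\ norm2 h < d4).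
{ pose proof (Rmin_l d0 (Rmin (Rmin d1 d2) (Rmin d3 d4))).
  pose proof (Rmin_r d0 (Rmin (Rmin d1 d2) (Rmin d3 d4))).
  pose proof (Rmin_l (Rmin d1 d2) (Rmin d3 d4)). pose proof (Rmin_r (Rmin d1 d2) (Rmin d3 d4)).
  pose proof (Rmin_l d1 d2). pose proof (Rmin_r d1 d2).
  pose proof (Rmin_l d3 d4). pose proof (Rmin_r d3 d4). lra. }
clear Hh. destruct HH as (H0 & H1 & H2 & H3 & H4).
split; [auto|].
assert (Hn : forall t, 0 <= t <= 1 -> norm2 (scal2 (RtoC t) h) = t * norm2 h /\
  norm2 (scal2 (RtoC t) h) <= norm2 h).
{ intros t Ht. rewrite norm2_scal2, Cmod_R, Rabs_pos_eq by lra.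
  pose proof (norm2_ge_0 h). split; nra. }
(* The mean value theorem is applied to F on [0, 1]. *)
set (F := fun t => rho (translate x t h) - t * dirder rho h x - t ^ 2 / 2 * hessian rho x h).
set (dF := fun t => dirder rho h (translate x t h) - dirder rho h x - t * hessian rho x h).
assert (HF : forall t, 0 <= t <= 1 -> is_derive F t (dF t)).
{ intros t Ht.
  assert (HUt : U (translate x t h)).
  { rewrite translate_add2. apply B0. pose proof (Hn t Ht). lra. }
  assert (D1 : is_derive (fun t => rho (translate x t h)) t (dirder rho h (translate x t h))).
  { destruct (real_differentiable _ _ (HC1 _ HUt)) as (_ & HD & _).
    specialize (HD h).
    apply (is_derive_ext (fun s => rho (translate (translate x t h) (s - t) h))).
    - intros s. rewrite translate_translate. f_equal. f_equal. ring.
    - rewrite <- (Rmult_1_l (dirder rho h (translate x t h))).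
      apply (is_derive_comp (fun s => rho (translate (translate x t h) s h))
              (fun s => s - t)).
      + replace (t - t) with 0 by ring. exact HD.
      + auto_derive; auto; ring. }
  unfold F, dF.
  apply (is_derive_minus (fun t => rho (translate x t h) - t * dirder rho h x)
    (fun t => t ^ 2 / 2 * hessian rho x h)).
  - apply (is_derive_minus (fun t => rho (translate x t h)) (fun t => t * dirder rho h x)).
    + exact D1.
    + auto_derive; auto; ring.
  - auto_derive; auto; field. }
destruct (MVT_gen F 0 1 dF) as (t & Ht & E).
- intros s Hs. rewrite Rmin_left, Rmax_right in Hs by lra. apply HF; lra.
- intros s Hs. rewrite Rmin_left, Rmax_right in Hs by lra.
  apply continuity_pt_filterlim.
  apply (ex_derive_continuous F). exists (dF s). apply HF; lra.
- rewrite Rmin_left, Rmax_right in Ht by lra.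
  destruct (Hn t Ht) as [N1 N2].
  replace (rho (add2 x h) - rho x - dirder rho h x - hessian rho x h / 2) with (dF t).
  2:{ rewrite Rminus_0_r, Rmult_1_r in E. rewrite <- E. unfold F.
      rewrite !translate_add2.
      replace (scal2 1%R h) with h.
      2:{ unfold scal2. rewrite !Cmult_1_l. apply surjective_pairing. }
      replace (add2 x (scal2 0%R h)) with x.
      2:{ unfold add2, scal2; simpl. rewrite !Cmult_0_l, !Cplus_0_r.
          apply surjective_pairing. }
      field. }
  unfold dF.
  assert (HUt : U (translate x t h)).
  { rewrite translate_add2. apply B0. lra. }
  destruct (real_differentiable _ _ (HC1 _ HUt)) as (_ & _ & L1).
  destruct (real_differentiable _ _ (HC1 _ Hx)) as (_ & _ & L0).
  rewrite (L1 h), (L0 h).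
  assert (HBlin : forall v, dirder (dirder rho v) (scal2 (RtoC t) h) x =
    t * (Re (fst h) * dirder (dirder rho v) e1 x + Im (fst h) * dirder (dirder rho v) f1 x +
         Re (snd h) * dirder (dirder rho v) e2 x + Im (snd h) * dirder (dirder rho v) f2 x)).
  { intros v. destruct (HC2 v) as [HC3 _].
    destruct (real_differentiable _ _ (HC3 x Hx)) as (_ & _ & LB).
    rewrite (LB (scal2 (RtoC t) h)). unfold scal2, Re, Im; simpl. ring. }
  specialize (B1 (scal2 (RtoC t) h) ltac:(lra)). specialize (B2 (scal2 (RtoC t) h) ltac:(lra)).
  specialize (B3 (scal2 (RtoC t) h) ltac:(lra)). specialize (B4 (scal2 (RtoC t) h) ltac:(lra)).
  rewrite HBlin, <- translate_add2 in B1, B2, B3, B4.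
  unfold hessian.
  match goal with |- Rabs ?X <= _ => match type of B1 with Rabs ?X1 <= _ =>
  match type of B2 with Rabs ?X2 <= _ => match type of B3 with Rabs ?X3 <= _ =>
  match type of B4 with Rabs ?X4 <= _ =>
    replace X with (Re (fst h) * X1 + Im (fst h) * X2 + Re (snd h) * X3 + Im (snd h) * X4)
      by ring; set (r1 := X1) in *; set (r2 := X2) in *; set (r3 := X3) in *;
      set (r4 := X4) in * end end end end end.
  destruct (coordinates_le_norm2 h) as (A1 & A2 & A3 & A4).
  pose proof (norm2_ge_0 h).
  assert (M : forall a r, Rabs a <= norm2 h ->
    Rabs r <= eps / 4 * norm2 (scal2 (RtoC t) h) -> Rabs (a * r) <= eps / 4 * norm2 h ^ 2).
  { intros a r Ha Hr. rewrite Rabs_mult.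
    replace (eps / 4 * norm2 h ^ 2) with (norm2 h * (eps / 4 * norm2 h)) by ring.
    apply Rmult_le_compat; try apply Rabs_pos; auto.
    eapply Rle_trans; [exact Hr|]. apply Rmult_le_compat_l; lra. }
  pose proof (M _ _ A1 B1) as M1. pose proof (M _ _ A2 B2) as M2.
  pose proof (M _ _ A3 B3) as M3. pose proof (M _ _ A4 B4) as M4.
  pose proof (Rabs_triang (Re (fst h) * r1 + Im (fst h) * r2 + Re (snd h) * r3) (Im (snd h) * r4)).
  pose proof (Rabs_triang (Re (fst h) * r1 + Im (fst h) * r2) (Re (snd h) * r3)).
  pose proof (Rabs_triang (Re (fst h) * r1) (Im (fst h) * r2)).
  lra.
Qed.

Lemma filterdiff_linear_C2 (f : C2 -> C2) (x : C2) (L : C2 -> C2) :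
  filterdiff (K := C_AbsRing) f (locally x) L ->
  (forall u v, L (add2 u v) = add2 (L u) (L v)) /\
  (forall c v, L (scal2 c v) = scal2 c (L v)).
Proof. intros [[H1 H2 _] _]. split; [exact H1|exact H2]. Qed.

(** The complex line parametrized by c + z v. *)
Definition line (c v : C2) (z : C) : C2 := add2 c (scal2 z v).

Lemma line_plus c v z h : line c v (z + h)%C = add2 (line c v z) (scal2 h v).
Proof. unfold line, add2, scal2; simpl. f_equal; ring. Qed.

Lemma line_e1 (z w : C) : line (RtoC 0, w) e1 z = (z, w).
Proof. unfold line, add2, scal2, e1; simpl. f_equal; ring. Qed.

Lemma line_e2 (z w : C) : line (z, RtoC 0) e2 w = (z, w).
Proof. unfold line, add2, scal2, e2; simpl. f_equal; ring. Qed.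

Lemma cdiff_line (f : C2 -> C) (c v : C2) (z : C) (L : C2 -> C) :
  filterdiff (K := C_AbsRing) (V := C_NormedModule) f (locally (line c v z)) L ->
  cdiff (fun z => f (line c v z)) z (L v).
Proof.
intros HL eps He. pose proof (norm2_ge_0 v) as Hv.
destruct (filterdiff_eps _ _ _ HL (eps / (norm2 v + 1))) as (d & Hd & Hf);
  [apply Rdiv_lt_0_compat; lra|].
exists (d / (norm2 v + 1)). split; [apply Rdiv_lt_0_compat; lra|].
intros h Hh. apply Rlt_div_r in Hh; [|lra].
pose proof (Cmod_ge_0 h) as Hh0.
pose proof (norm_C2_le (scal2 h v)) as Hn. rewrite norm2_scal2 in Hn.
specialize (Hf (scal2 h v) ltac:(nra)).
assert (Hsc : L (scal2 h v) = (h * L v)%C).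
{ destruct HL as [[_ Hsc _] _]. exact (Hsc h v). }
change (Cmod (f (add2 (line c v z) (scal2 h v)) - f (line c v z) - L (scal2 h v))%C <=
  eps / (norm2 v + 1) *
  norm (V := prod_NormedModule C_AbsRing C_NormedModule C_NormedModule) (scal2 h v)) in Hf.
rewrite <- line_plus, Hsc, (Cmult_comm h) in Hf.
eapply Rle_trans; [exact Hf|].
eapply Rle_trans; [apply Rmult_le_compat_l; [|exact Hn]|].
{ apply Rlt_le, Rdiv_lt_0_compat; lra. }
replace (eps / (norm2 v + 1) * (Cmod h * norm2 v))
  with (norm2 v / (norm2 v + 1) * (eps * Cmod h)) by (field; lra).
assert (norm2 v / (norm2 v + 1) <= 1) by (apply Rle_div_l; lra).
assert (0 <= eps * Cmod h) by nra. nra.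
Qed.

Lemma cdiff_line_components (f : C2 -> C2) (c v : C2) (z : C) (L : C2 -> C2) :
  filterdiff (K := C_AbsRing) f (locally (line c v z)) L ->
  cdiff (fun z => fst (f (line c v z))) z (fst (L v)) /\
  cdiff (fun z => snd (f (line c v z))) z (snd (L v)).
Proof.
intros HL. split.
- apply (cdiff_line (fun x => fst (f x)) c v z (fun x => fst (L x))).
  apply (filterdiff_comp' f fst _ L fst HL), filterdiff_linear, is_linear_fst.
- apply (cdiff_line (fun x => snd (f x)) c v z (fun x => snd (L x))).
  apply (filterdiff_comp' f snd _ L snd HL), filterdiff_linear, is_linear_snd.
Qed.

Lemma ex_filterdiff_Cmult (f g : C2 -> C) (x : C2) :
  ex_filterdiff (K := C_AbsRing) (V := C_NormedModule) f (locally x) ->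
  ex_filterdiff (K := C_AbsRing) (V := C_NormedModule) g (locally x) ->
  ex_filterdiff (K := C_AbsRing) (V := C_NormedModule) (fun x => f x * g x)%C (locally x).
Proof.
intros [L HL] Hg.
apply (ex_filterdiff_scal_fct (K := C_AbsRing) (V := C_NormedModule) x f g); auto.
- exact Cmult_comm.
- exists L. destruct HL as [[H1 H2 H3] H4]. split; [split|]; [exact H1|exact H2|exact H3|exact H4].
Qed.

Lemma filterdiff_Cinv (z : C) : z <> 0 ->
  filterdiff (K := C_AbsRing) (U := C_NormedModule) (V := C_NormedModule)
    Cinv (locally z) (fun h => h * (- / (z * z)))%C.
Proof.
intros Hz. split.
- destruct (is_linear_scal_l (K := C_AbsRing) (V := C_NormedModule) (- / (z * z))%C)
    as [H1 H2 H3].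
  split; [exact H1|exact H2|exact H3].
- intros x Hx.
  assert (E : x = z) by (symmetry; apply is_filter_lim_locally_unique; exact Hx).
  subst x. intros eps.
  apply (locally_le_locally_norm (V := C_NormedModule)).
  assert (Hz0 : 0 < Cmod z) by (apply Cmod_gt_0; auto).
  assert (Hz3 : 0 < Cmod z ^ 3) by (apply pow_lt; auto).
  assert (Hd : 0 < Rmin (Cmod z / 2) (eps * Cmod z ^ 3 / 2)).
  { pose proof (cond_pos eps). apply Rmin_pos; [lra|]. nra. }
  exists (mkposreal _ Hd). intros y Hy.
  change (Cmod (y - z)%C < Rmin (Cmod z / 2) (eps * Cmod z ^ 3 / 2)) in Hy.
  change (Cmod (/ y - / z - (y - z) * (- / (z * z)))%C <= eps * Cmod (y - z)%C).
  pose proof (Rmin_l (Cmod z / 2) (eps * Cmod z ^ 3 / 2)).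
  pose proof (Rmin_r (Cmod z / 2) (eps * Cmod z ^ 3 / 2)).
  assert (Hy2 : Cmod z / 2 < Cmod y).
  { pose proof (Cmod_triangle y (- (y - z))%C) as Ht.
    replace (y + - (y - z))%C with z in Ht by ring. rewrite Cmod_opp in Ht. lra. }
  assert (Hy0 : y <> RtoC 0) by (intros E; rewrite E, Cmod_0 in Hy2; lra).
  replace (/ y - / z - (y - z) * (- / (z * z)))%C with ((y - z) * ((y - z) / (y * z * z)))%C
    by (field; auto).
  rewrite Cmod_mult, Rmult_comm. apply Rmult_le_compat_r; [apply Cmod_ge_0|].
  rewrite Cmod_div by (repeat apply Cmult_neq_0; auto).
  rewrite !Cmod_mult. pose proof (cond_pos eps).
  apply Rle_div_l.
  { repeat apply Rmult_lt_0_compat; auto. lra. }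
  apply Rle_trans with (eps * Cmod z ^ 3 / 2); [lra|].
  replace (eps * Cmod z ^ 3 / 2) with (eps * (Cmod z / 2 * Cmod z * Cmod z)) by field.
  apply Rmult_le_compat_l; [lra|]. repeat apply Rmult_le_compat_r; lra.
Qed.

Lemma ex_filterdiff_Cdiv (f g : C2 -> C) (x : C2) :
  ex_filterdiff (K := C_AbsRing) (V := C_NormedModule) f (locally x) ->
  ex_filterdiff (K := C_AbsRing) (V := C_NormedModule) g (locally x) ->
  g x <> 0 ->
  ex_filterdiff (K := C_AbsRing) (V := C_NormedModule) (fun x => f x / g x)%C (locally x).
Proof.
intros Hf [L HL] Hx. apply ex_filterdiff_Cmult; auto.
eexists. exact (filterdiff_comp' g Cinv x L _ HL (filterdiff_Cinv _ Hx)).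
Qed.

(** * Peak functions at strictly pseudoconvex boundary points *)

Lemma dirder_ext (f g : C2 -> R) v p :
  (forall q, f q = g q) -> dirder f v p = dirder g v p.
Proof. intros E. apply Derive_ext. intros t; apply E. Qed.

Lemma dW_real (rho : C2 -> R) (e p : C2) :
  dW e (fun q => RtoC (rho q)) p = (dirder rho e p / 2, - (dirder rho (scal2 Ci e) p / 2)).
Proof.
unfold dW, Cdirder.
assert (Z : forall v, dirder (fun q => Im (RtoC (rho q))) v p = 0)
  by (intros v; exact (Derive_const 0 0)).
rewrite !Z.
change (dirder (fun q => Re (RtoC (rho q))) e p) with (dirder rho e p).
change (dirder (fun q => Re (RtoC (rho q))) (scal2 Ci e) p) with (dirder rho (scal2 Ci e) p).
unfold Cdiv, Cminus, Cmult, Cinv, Ci, RtoC, Cplus, Copp; simpl. f_equal; field.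
Qed.

Lemma dW_dWbar_real (rho : C2 -> R) (ej ek p : C2) :
  dW ej (dWbar ek (fun q => RtoC (rho q))) p =
  ((dirder (dirder rho ek) ej p +
    dirder (dirder rho (scal2 Ci ek)) (scal2 Ci ej) p) / 4,
   (dirder (dirder rho (scal2 Ci ek)) ej p -
    dirder (dirder rho ek) (scal2 Ci ej) p) / 4).
Proof.
set (B := fun u w => dirder (dirder rho u) w p).
assert (E : forall q, dWbar ek (fun q => RtoC (rho q)) q =
  (/ 2 * dirder rho ek q, / 2 * dirder rho (scal2 Ci ek) q)).
{ intros q. unfold dWbar, Cdirder.
  assert (Z : forall v, dirder (fun q => Im (RtoC (rho q))) v q = 0)
    by (intros v; exact (Derive_const 0 0)).
  rewrite !Z.
  change (dirder (fun q => Re (RtoC (rho q))) ek q) with (dirder rho ek q).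
  change (dirder (fun q => Re (RtoC (rho q))) (scal2 Ci ek) q) with (dirder rho (scal2 Ci ek) q).
  unfold Cdiv, Cminus, Cmult, Cinv, Ci, RtoC, Cplus, Copp; simpl. f_equal; field. }
unfold dW, Cdirder.
assert (ER : forall v, dirder (fun q => Re (dWbar ek (fun q => RtoC (rho q)) q)) v p =
  / 2 * B ek v).
{ intros v. rewrite (dirder_ext _ (fun q => / 2 * dirder rho ek q)).
  - apply Derive_scal.
  - intros q; rewrite E; reflexivity. }
assert (EI : forall v, dirder (fun q => Im (dWbar ek (fun q => RtoC (rho q)) q)) v p =
  / 2 * B (scal2 Ci ek) v).
{ intros v. rewrite (dirder_ext _ (fun q => / 2 * dirder rho (scal2 Ci ek) q)).
  - apply Derive_scal.
  - intros q; rewrite E; reflexivity. }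
rewrite !ER, !EI. unfold B.
unfold Cdiv, Cminus, Cmult, Cinv, Ci, RtoC, Cplus, Copp; simpl. f_equal; field.
Qed.

(** The second-order Taylor term is the Levi form plus the real part of a
    complex quadratic form. *)
Lemma hessian_levi (rho : C2 -> R) (p : C2) :
  exists q11 q12 q22 : C, forall h : C2,
    hessian rho p h / 2 - Re (levi_form rho p h) =
    Re (q11 * fst h * fst h + q12 * fst h * snd h + q22 * snd h * snd h)%C.
Proof.
set (B := fun u w => dirder (dirder rho u) w p).
exists ((B e1 e1 - B f1 f1) / 4, - (B e1 f1 + B f1 e1) / 4),
  ((B e1 e2 + B e2 e1 - B f1 f2 - B f2 f1) / 4,
   - (B e1 f2 + B f2 e1 + B f1 e2 + B e2 f1) / 4),
  ((B e2 e2 - B f2 f2) / 4, - (B e2 f2 + B f2 e2) / 4).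
intros [[x1 y1] [x2 y2]].
unfold levi_form. cbv zeta.
rewrite (dW_dWbar_real rho e1 e1), (dW_dWbar_real rho e1 e2),
  (dW_dWbar_real rho e2 e1), (dW_dWbar_real rho e2 e2).
fold f1 f2. unfold hessian. cbv zeta.
change (fun u w : C2 => dirder (dirder rho u) w p) with B.
repeat match goal with |- context [dirder (dirder rho ?u) ?w p] =>
  change (dirder (dirder rho u) w p) with (B u w) end.
unfold Cconj, Cplus, Cmult, Re, Im; simpl. field.
Qed.

(** The sesquilinear form on C^2 with the given matrix. *)
Definition sesqui (c11 c12 c21 c22 : C) (u v : C2) : C :=
  (c11 * (fst u * Cconj (fst v)) + c12 * (fst u * Cconj (snd v)) +
   (c21 * (snd u * Cconj (fst v)) + c22 * (snd u * Cconj (snd v))))%C.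

Lemma Cconj_plus (a b : C) : Cconj (a + b)%C = (Cconj a + Cconj b)%C.
Proof. unfold Cconj, Cplus; simpl; f_equal; ring. Qed.

Lemma Cconj_mult (a b : C) : Cconj (a * b)%C = (Cconj a * Cconj b)%C.
Proof. unfold Cconj, Cmult; simpl; f_equal; ring. Qed.

(** A form that is positive on the kernel of a nonzero linear form becomes
    positive definite after adding a multiple of the squared modulus of the
    linear form. *)
Lemma sesqui_definite (c11 c12 c21 c22 m1 m2 : C) :
  (m1, m2) <> origin ->
  (forall v, v <> origin -> (m1 * fst v + m2 * snd v)%C = 0 ->
     0 < Re (sesqui c11 c12 c21 c22 v v)) ->
  exists K eps, 0 < K /\ 0 < eps /\ forall h,
    eps * norm2 h ^ 2 <=
    Re (sesqui c11 c12 c21 c22 h h) + K * Cmod (m1 * fst h + m2 * snd h)%C ^ 2.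
Proof.
intros Hm Hpos.
set (S := sesqui c11 c12 c21 c22) in *.
(* t spans the kernel of the linear form and n its orthogonal complement; h = a t + b n
   below, and the cross terms are absorbed by a part of T |a|^2. *)
set (t := (- m2, m1)%C : C2).
set (n := (Cconj m1, Cconj m2) : C2).
set (T := Re (S t t)).
assert (HT : 0 < T).
{ apply Hpos; [|simpl; ring].
  intros E. apply Hm.
  pose proof (f_equal fst E) as E1. pose proof (f_equal snd E) as E2. simpl in E1, E2.
  unfold origin. rewrite E2. f_equal.
  replace m2 with (- - m2)%C by ring. rewrite E1. ring. }
assert (Hs : 0 < Cmod m1 + Cmod m2).
{ pose proof (Cmod_ge_0 m1). pose proof (Cmod_ge_0 m2).
  destruct (Rle_lt_dec (Cmod m1 + Cmod m2) 0); auto.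
  exfalso; apply Hm. unfold origin. f_equal; apply Cmod_eq_0; lra. }
set (Lam := Cmod m1 ^ 2 + Cmod m2 ^ 2).
assert (HLam : 0 < Lam).
{ unfold Lam. pose proof (Cmod_ge_0 m1). pose proof (Cmod_ge_0 m2).
  pose proof (pow2_ge_0 (Cmod m1 - Cmod m2)). pose proof (pow_lt _ 2 Hs). nra. }
assert (HLamC : (m1 * Cconj m1 + m2 * Cconj m2)%C = RtoC Lam).
{ rewrite <- !Cmod2_conj. unfold Lam. rewrite RtoC_plus, !RtoC_pow. auto. }
assert (HLamC0 : RtoC Lam <> 0) by (intros E; injection E; lra).
set (M := Cmod (S t n) + Cmod (S n t)).
set (N := Cmod (S n n)).
assert (HM : 0 <= M) by (unfold M; pose proof (Cmod_ge_0 (S t n));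
  pose proof (Cmod_ge_0 (S n t)); lra).
assert (HN : 0 <= N) by apply Cmod_ge_0.
set (X := T / 2 + M ^ 2 / (2 * T) + N).
assert (HX : 0 < X).
{ unfold X. assert (0 <= M ^ 2 / (2 * T)).
  { apply Rmult_le_pos; [apply pow2_ge_0|]. apply Rlt_le, Rinv_0_lt_compat; lra. }
  lra. }
set (W := (Cmod m1 + Cmod m2) ^ 2).
assert (HW : 0 < W) by (apply pow_lt; auto).
exists (X / Lam ^ 2), (T / (4 * W)). split; [|split].
- apply Rdiv_lt_0_compat; auto. apply pow_lt; auto.
- apply Rdiv_lt_0_compat; lra.
- intros h.
  set (a := ((- Cconj m2 * fst h + Cconj m1 * snd h) / Lam)%C).
  set (b := ((m1 * fst h + m2 * snd h) / Lam)%C).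
  assert (E1 : fst h = (a * - m2 + b * Cconj m1)%C).
  { unfold a, b. transitivity ((m1 * Cconj m1 + m2 * Cconj m2) / Lam * fst h)%C.
    - rewrite HLamC. field. auto.
    - field. auto. }
  assert (E2 : snd h = (a * m1 + b * Cconj m2)%C).
  { unfold a, b. transitivity ((m1 * Cconj m1 + m2 * Cconj m2) / Lam * snd h)%C.
    - rewrite HLamC. field. auto.
    - field. auto. }
  assert (ES : S h h = ((a * Cconj a) * S t t + (a * Cconj b) * S t n +
     (b * Cconj a) * S n t + (b * Cconj b) * S n n)%C).
  { unfold S, sesqui, t, n. rewrite E1, E2. simpl.
    rewrite !Cconj_plus, !Cconj_mult. ring. }
  assert (Eb : Cmod (m1 * fst h + m2 * snd h)%C = Lam * Cmod b).
  { unfold b. rewrite Cmod_div, Cmod_R, Rabs_pos_eq by (auto; lra). field. lra. }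
  rewrite Eb, ES. rewrite <- !Cmod2_conj.
  rewrite !re_plus, !re_scal_l. fold T.
  pose proof (re_le_Cmod (a * Cconj b * S t n)%C) as R1.
  pose proof (re_le_Cmod (b * Cconj a * S n t)%C) as R2.
  pose proof (re_le_Cmod (S n n)) as R3.
  rewrite !Cmod_mult, Cmod_conj in R1, R2.
  apply Rabs_le_between in R1. apply Rabs_le_between in R2. apply Rabs_le_between in R3.
  fold N in R3.
  set (p := Cmod a) in *. set (q := Cmod b) in *.
  assert (Hp : 0 <= p) by apply Cmod_ge_0. assert (Hq : 0 <= q) by apply Cmod_ge_0.
  assert (HnA : norm2 h <= (Cmod m1 + Cmod m2) * (p + q)).
  { unfold norm2. rewrite E1, E2.
    pose proof (Cmod_triangle (a * - m2)%C (b * Cconj m1)%C) as T1.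
    pose proof (Cmod_triangle (a * m1)%C (b * Cconj m2)%C) as T2.
    rewrite !Cmod_mult, (Cmod_opp m2), !Cmod_conj in T1.
    rewrite !Cmod_mult, !Cmod_conj in T2. fold p q in T1, T2. lra. }
  assert (HnB : norm2 h ^ 2 <= W * (2 * (p ^ 2 + q ^ 2))).
  { pose proof (norm2_ge_0 h). unfold W.
    apply Rle_trans with (((Cmod m1 + Cmod m2) * (p + q)) ^ 2).
    - apply pow_incr; lra.
    - rewrite Rpow_mult_distr. apply Rmult_le_compat_l; [apply pow2_ge_0|].
      pose proof (pow2_ge_0 (p - q)). lra. }
  apply Rle_trans with (T / 2 * (p ^ 2 + q ^ 2)).
  + replace (T / 2 * (p ^ 2 + q ^ 2)) with (T / (4 * W) * (W * (2 * (p ^ 2 + q ^ 2))))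
      by (field; lra).
    apply Rmult_le_compat_l; auto. apply Rlt_le, Rdiv_lt_0_compat; lra.
  + replace (X / Lam ^ 2 * (Lam * q) ^ 2) with (X * q ^ 2) by (field; lra).
    assert (HMM : M * (p * q) <= T / 2 * p ^ 2 + M ^ 2 / (2 * T) * q ^ 2).
    { assert (0 <= T / 2 * (p - M / T * q) ^ 2).
      { apply Rmult_le_pos; [lra|apply pow2_ge_0]. }
      replace (T / 2 * p ^ 2 + M ^ 2 / (2 * T) * q ^ 2)
        with (T / 2 * (p - M / T * q) ^ 2 + M * (p * q)) by (field; lra). lra. }
    assert (HN2 : - N * q ^ 2 <= q ^ 2 * Re (S n n)).
    { pose proof (pow2_ge_0 q). nra. }
    assert (Rc : - (M * (p * q)) <= Re (a * Cconj b * S t n)%C + Re (b * Cconj a * S n t)%C).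
    { unfold M. lra. }
    unfold X. lra.
Qed.

Lemma closure_defining_function (D U : C2 -> Prop) (rho : C2 -> R) (x : C2) :
  local_defining_function D U rho -> U x -> closure D x -> rho x <= 0.
Proof.
intros (_ & _ & HD & _) Hx Hc.
destruct (HD x Hx) as [H1 H2].
destruct (classic (D x)) as [Hin|Hout].
- apply Rlt_le, H1, Hin.
- right. apply H2. split; auto. intros V _ HV. exists x; auto.
Qed.

(** A complex quadratic polynomial on C^2 that vanishes at 0; (m1, m2) is its
    linear part. *)
Definition quadratic (m1 m2 q11 q12 q22 : C) (h : C2) : C :=
  (m1 * fst h + m2 * snd h +
   (q11 * fst h * fst h + q12 * fst h * snd h + q22 * snd h * snd h))%C.

(** Local holomorphic peak function at a strictly pseudoconvex boundary point
    q.  The function rho + 2 K rho^2 is nonpositive on the closure of D near q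
    and has a positive definite Levi form at q when K is large; the polynomial
    is the holomorphic part of its second-order expansion. *)
Lemma levi_polynomial (D : C2 -> Prop) (q : C2) :
  strictly_pseudoconvex_boundary D -> boundary D q ->
  exists (m1 m2 q11 q12 q22 : C) (eps delta : R), 0 < eps /\ 0 < delta /\
    forall h, norm2 h < delta -> closure D (add2 q h) ->
    Re (quadratic m1 m2 q11 q12 q22 h) <= - eps * norm2 h ^ 2.
Proof.
intros Hspsc Hq.
destruct (Hspsc q Hq) as (U & rho & HUq & Hdef & Hlevi).
pose proof Hdef as (HU & Hsm & Hside & Hnz).
assert (HC2 : Cn 2 U rho) by apply Hsm.
assert (Hrho0 : rho q = 0) by (apply (proj2 (Hside q HUq)); auto).
destruct (real_differentiable rho q (proj1 HC2 q HUq)) as (_ & _ & Hlin).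
set (m1 := (dirder rho e1 q, - dirder rho f1 q) : C).
set (m2 := (dirder rho e2 q, - dirder rho f2 q) : C).
assert (Hre : forall h, dirder rho h q = Re (m1 * fst h + m2 * snd h)%C).
{ intros h. rewrite Hlin. unfold m1, m2, Re, Im; simpl. ring. }
assert (Hm : (m1, m2) <> origin).
{ intros E.
  pose proof (f_equal (fun v => Re (fst v)) E) as E1.
  pose proof (f_equal (fun v => Im (fst v)) E) as E2.
  pose proof (f_equal (fun v => Re (snd v)) E) as E3.
  pose proof (f_equal (fun v => Im (snd v)) E) as E4. simpl in E1, E2, E3, E4.
  destruct (Hnz q HUq Hq) as [v Hv]. apply Hv. rewrite Hlin.
  replace (dirder rho e1 q) with 0 by lra. replace (dirder rho f1 q) with 0 by lra.
  replace (dirder rho e2 q) with 0 by lra. replace (dirder rho f2 q) with 0 by lra. ring. }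
set (r := fun q => RtoC (rho q)).
destruct (sesqui_definite (dW e1 (dWbar e1 r) q) (dW e1 (dWbar e2 r) q)
  (dW e2 (dWbar e1 r) q) (dW e2 (dWbar e2 r) q) m1 m2 Hm) as (K & eps & HK & Heps & Hdefin).
{ intros v Hv Hv0. apply (Hlevi v Hv).
  rewrite !dW_real. fold f1 f2.
  transitivity ((m1 * fst v + m2 * snd v) * / 2)%C.
  - unfold m1, m2, Cplus, Cmult, Cinv, RtoC; simpl. f_equal; field.
  - rewrite Hv0. ring. }
assert (Hdefin' : forall h, eps * norm2 h ^ 2 <=
  Re (levi_form rho q h) + K * Cmod (m1 * fst h + m2 * snd h)%C ^ 2) by exact Hdefin.
clear Hdefin.
destruct (hessian_levi rho q) as (p11 & p12 & p22 & Hp).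
(* With d = Re (m . h), one has 2 K d^2 = K Re (m . h)^2 + K |m . h|^2. *)
exists m1, m2, (p11 + K * m1 * m1)%C, (p12 + 2 * K * m1 * m2)%C, (p22 + K * m2 * m2)%C.
set (A := Cmod m1 + Cmod m2).
assert (HA : 0 <= A) by (unfold A; pose proof (Cmod_ge_0 m1); pose proof (Cmod_ge_0 m2); lra).
assert (Hd : forall h, Rabs (dirder rho h q) <= A * norm2 h).
{ intros h. rewrite Hre. eapply Rle_trans; [apply re_le_Cmod|].
  eapply Rle_trans; [apply Cmod_triangle|]. rewrite !Cmod_mult. unfold A, norm2.
  pose proof (Cmod_ge_0 m1). pose proof (Cmod_ge_0 m2).
  pose proof (Cmod_ge_0 (fst h)). pose proof (Cmod_ge_0 (snd h)). nra. }
assert (HB : exists B, 0 <= B /\ forall h, Rabs (hessian rho q h / 2) <= B * norm2 h ^ 2).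
{ set (b := fun u w => Rabs (dirder (dirder rho u) w q)).
  set (rw := fun u => b u e1 + b u f1 + b u e2 + b u f2).
  assert (Hb : forall u w, 0 <= b u w) by (intros; apply Rabs_pos).
  assert (Hrw : forall u, 0 <= rw u).
  { intros u. unfold rw. pose proof (Hb u e1). pose proof (Hb u f1).
    pose proof (Hb u e2). pose proof (Hb u f2). lra. }
  exists (rw e1 + rw f1 + rw e2 + rw f2). split.
  { pose proof (Hrw e1). pose proof (Hrw f1). pose proof (Hrw e2). pose proof (Hrw f2). lra. }
  intros h.
  destruct (coordinates_le_norm2 h) as (C1 & C2 & C3 & C4).
  pose proof (norm2_ge_0 h) as Hn.
  assert (P1 : forall x y X Y, Rabs x <= X -> Rabs y <= Y -> Rabs (x * y) <= X * Y).
  { intros. rewrite Rabs_mult. apply Rmult_le_compat; auto; apply Rabs_pos. }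
  assert (P2 : forall x y X Y, Rabs x <= X -> Rabs y <= Y -> Rabs (x + y) <= X + Y).
  { intros. eapply Rle_trans; [apply Rabs_triang|lra]. }
  assert (P3 : forall u w, Rabs (dirder (dirder rho u) w q) <= b u w) by (intros; apply Rle_refl).
  assert (P4 : Rabs (hessian rho q h) <= norm2 h * (norm2 h * b e1 e1 + norm2 h * b e1 f1 +
      norm2 h * b e1 e2 + norm2 h * b e1 f2) + norm2 h * (norm2 h * b f1 e1 + norm2 h * b f1 f1 +
      norm2 h * b f1 e2 + norm2 h * b f1 f2) + norm2 h * (norm2 h * b e2 e1 + norm2 h * b e2 f1 +
      norm2 h * b e2 e2 + norm2 h * b e2 f2) + norm2 h * (norm2 h * b f2 e1 + norm2 h * b f2 f1 +
      norm2 h * b f2 e2 + norm2 h * b f2 f2)).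
  { unfold hessian. repeat first [apply P2 | apply P1]; auto. }
  unfold Rdiv. rewrite Rabs_mult, (Rabs_pos_eq (/ 2)) by lra.
  pose proof (Rabs_pos (hessian rho q h)).
  apply Rle_trans with (Rabs (hessian rho q h)); [lra|].
  eapply Rle_trans; [exact P4|]. unfold rw. apply Req_le; ring. }
destruct HB as (B & HB0 & HB).
destruct (taylor2 U rho q HU HUq HC2 (Rmin 1 (eps / 4))) as (d0 & Hd0 & Htay).
{ apply Rmin_pos; lra. }
set (E := 2 * K * (B + 1) * (2 * A + B + 1)).
assert (HE : 0 < E) by (unfold E; repeat apply Rmult_lt_0_compat; lra).
set (F := 2 * K * (A + B + 1)).
assert (HF : 0 < F) by (unfold F; repeat apply Rmult_lt_0_compat; lra).
exists (eps / 2), (Rmin (Rmin d0 1) (Rmin (eps / (4 * E)) (/ F))).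
split; [lra|]. split.
{ repeat apply Rmin_pos; try lra; [apply Rdiv_lt_0_compat; lra|apply Rinv_0_lt_compat; auto]. }
intros h Hh Hcl.
set (nn := norm2 h) in *.
assert (HH : nn < d0 /\ nn < 1 /\ nn < eps / (4 * E) /\ nn < / F).
{ pose proof (Rmin_l (Rmin d0 1) (Rmin (eps / (4 * E)) (/ F))).
  pose proof (Rmin_r (Rmin d0 1) (Rmin (eps / (4 * E)) (/ F))).
  pose proof (Rmin_l d0 1). pose proof (Rmin_r d0 1).
  pose proof (Rmin_l (eps / (4 * E)) (/ F)). pose proof (Rmin_r (eps / (4 * E)) (/ F)). lra. }
clear Hh. destruct HH as (H1 & H2 & H3 & H4).
assert (Hnn : 0 <= nn) by apply norm2_ge_0.
assert (H3' : E * nn <= eps / 4).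
{ apply Rlt_div_r in H3; [|lra]. lra. }
assert (H4' : F * nn <= 1).
{ apply Rmult_lt_compat_l with (r := F) in H4; auto. rewrite Rinv_r in H4; lra. }
destruct (Htay h H1) as [HUh Ht].
assert (Hr0 : rho (add2 q h) <= 0).
{ apply (closure_defining_function D U rho); auto. }
specialize (Hd h). specialize (HB h). fold nn in Hd, HB, Ht.
rewrite Hrho0, Rminus_0_r in Ht.
set (rr := rho (add2 q h)) in *. set (dd := dirder rho h q) in *.
set (bb := hessian rho q h / 2) in *.
assert (Ht1 : Rabs (rr - dd - bb) <= nn ^ 2).
{ eapply Rle_trans; [exact Ht|]. rewrite <- (Rmult_1_l (nn ^ 2)) at 2.
  apply Rmult_le_compat_r; [apply pow2_ge_0|apply Rmin_l]. }
assert (Ht2 : Rabs (rr - dd - bb) <= eps / 4 * nn ^ 2).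
{ eapply Rle_trans; [exact Ht|].
  apply Rmult_le_compat_r; [apply pow2_ge_0|apply Rmin_r]. }
assert (Hrd : Rabs (rr - dd) <= (B + 1) * nn ^ 2).
{ replace (rr - dd) with ((rr - dd - bb) + bb) by ring.
  eapply Rle_trans; [apply Rabs_triang|lra]. }
assert (Hsq : nn ^ 2 <= nn) by nra.
assert (Hr : Rabs rr <= (A + B + 1) * nn).
{ replace rr with ((rr - dd) + dd) by ring.
  eapply Rle_trans; [apply Rabs_triang|]. nra. }
assert (Hrds : Rabs (rr + dd) <= (2 * A + B + 1) * nn).
{ eapply Rle_trans; [apply Rabs_triang|]. lra. }
assert (Hdiff : 2 * K * Rabs (rr ^ 2 - dd ^ 2) <= eps / 4 * nn ^ 2).
{ replace (rr ^ 2 - dd ^ 2) with ((rr - dd) * (rr + dd)) by ring.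
  rewrite Rabs_mult.
  apply Rle_trans with (2 * K * (((B + 1) * nn ^ 2) * ((2 * A + B + 1) * nn))).
  - apply Rmult_le_compat_l; [lra|]. apply Rmult_le_compat; auto; apply Rabs_pos.
  - replace (2 * K * (((B + 1) * nn ^ 2) * ((2 * A + B + 1) * nn)))
      with ((E * nn) * nn ^ 2) by (unfold E; ring).
    apply Rmult_le_compat_r; auto. apply pow2_ge_0. }
(* Here |rho| <= 1 / (2 K), so rho <= 0 gives rho + 2 K rho^2 <= 0. *)
assert (Hneg : rr + 2 * K * rr ^ 2 <= 0).
{ rewrite Rabs_left1 in Hr by auto.
  assert (2 * K * - rr <= 1).
  { apply Rle_trans with (2 * K * ((A + B + 1) * nn)).
    - apply Rmult_le_compat_l; lra.
    - replace (2 * K * ((A + B + 1) * nn)) with (F * nn) by (unfold F; ring). auto. }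
  nra. }
specialize (Hdefin' h). fold nn in Hdefin'.
specialize (Hp h). fold bb in Hp. specialize (Hre h). fold dd in Hre.
apply Rabs_le_between in Ht2.
pose proof (Rle_abs (rr ^ 2 - dd ^ 2)) as Ha1.
pose proof (Rle_abs (- (rr ^ 2 - dd ^ 2))) as Ha2. rewrite Rabs_Ropp in Ha2.
assert (Hd2 : 2 * K * dd ^ 2 - eps / 4 * nn ^ 2 <= 2 * K * rr ^ 2) by nra.
set (Z := (m1 * fst h + m2 * snd h)%C) in *.
match goal with |- Re ?X <= _ => replace X with
  (Z + (p11 * fst h * fst h + p12 * fst h * snd h + p22 * snd h * snd h) + K * (Z * Z))%C
  by (unfold quadratic, Z; ring) end.
rewrite (re_plus (Z + _)%C), (re_plus Z), re_scal_l, re_mult, <- Hp, <- Hre.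
rewrite (Cmod2_alt Z), <- Hre in Hdefin'. lra.
Qed.

(** * Peak functions along discs and tangent vectors *)

Lemma cdiff_quadratic_line m1 m2 q11 q12 q22 (f : C2 -> C2) (c v : C2) (z : C) (q : C2) L :
  filterdiff (K := C_AbsRing) f (locally (line c v z)) L ->
  exists l, cdiff (fun z => quadratic m1 m2 q11 q12 q22 (sub2 (f (line c v z)) q)) z l /\
    (f (line c v z) = q -> l = pairing (m1, m2) (L v)).
Proof.
intros HL. destruct (cdiff_line_components _ _ _ _ _ HL) as [H1 H2].
assert (D1 : cdiff (fun z => fst (f (line c v z)) - fst q)%C z (fst (L v) + 0)%C)
  by (apply cdiff_plus; [auto|apply cdiff_const]).
assert (D2 : cdiff (fun z => snd (f (line c v z)) - snd q)%C z (snd (L v) + 0)%C)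
  by (apply cdiff_plus; [auto|apply cdiff_const]).
eexists. split.
- unfold quadratic, sub2; simpl fst; simpl snd.
  apply cdiff_plus; [apply cdiff_plus; apply cdiff_scal; [exact D1|exact D2]|].
  apply cdiff_plus; [apply cdiff_plus|];
    (apply cdiff_mult; [apply cdiff_scal; eassumption|eassumption]).
- intros E. cbv beta. rewrite E. unfold pairing; simpl. ring.
Qed.

Lemma quadratic_bound m1 m2 q11 q12 q22 :
  exists A, 0 <= A /\ forall h,
    Cmod (quadratic m1 m2 q11 q12 q22 h - pairing (m1, m2) h)%C <= A * norm2 h ^ 2.
Proof.
exists (Cmod q11 + Cmod q12 + Cmod q22).
pose proof (Cmod_ge_0 q11). pose proof (Cmod_ge_0 q12). pose proof (Cmod_ge_0 q22).
split; [lra|]. intros h.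
replace (quadratic m1 m2 q11 q12 q22 h - pairing (m1, m2) h)%C with
  (q11 * fst h * fst h + q12 * fst h * snd h + q22 * snd h * snd h)%C
  by (unfold quadratic, pairing; simpl; ring).
eapply Rle_trans; [apply Cmod_triangle|].
eapply Rle_trans; [apply Rplus_le_compat_r, Cmod_triangle|].
rewrite !Cmod_mult. unfold norm2.
pose proof (Cmod_ge_0 (fst h)). pose proof (Cmod_ge_0 (snd h)).
set (a := Cmod (fst h)) in *. set (b := Cmod (snd h)) in *.
assert (a * a <= (a + b) ^ 2) by nra.
assert (a * b <= (a + b) ^ 2) by nra.
assert (b * b <= (a + b) ^ 2) by nra.
rewrite !Rmult_assoc. nra.
Qed.

(** If a quadratic polynomial centred at q has real part at most 0 on H near q,
    then its linear part vanishes on the complex tangent vectors of H at q: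
    along a curve in H through q the real part is maximal at q. *)
Lemma quadratic_complex_tangent m1 m2 q11 q12 q22 (H : C2 -> Prop) (q v : C2) (delta : R) :
  0 < delta ->
  (forall x, norm2 (sub2 x q) < delta -> H x ->
     Re (quadratic m1 m2 q11 q12 q22 (sub2 x q)) <= 0) ->
  complex_tangent_vector H q v -> pairing (m1, m2) v = 0.
Proof.
intros Hd Hneg [Hv Hiv].
destruct (quadratic_bound m1 m2 q11 q12 q22) as (A & HA & Hquad).
assert (Key : forall v, tangent_vector H q v -> Re (pairing (m1, m2) v) = 0).
{ clear v Hv Hiv. intros v (gamma & H0 & Hloc & Hder).
  destruct Hloc as [d0 Hd0].
  set (M := Cmod m1 + Cmod m2).
  assert (HM : 0 <= M) by (unfold M; pose proof (Cmod_ge_0 m1); pose proof (Cmod_ge_0 m2); lra).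
  pose proof (norm2_ge_0 v) as Hnv.
  (* sg is the sign of the parameter: both sides of the curve are used. *)
  assert (Hup : forall eps, 0 < eps -> eps <= 1 -> forall sg, Rabs sg = 1 ->
     sg * Re (pairing (m1, m2) v) <= eps * (2 * M + A * (norm2 v + 2) ^ 2)).
  { intros eps He He1 sg Hsg.
    destruct (filterdiff_eps _ _ _ Hder eps He) as (d & Hdd & Hf).
    set (t := Rmin (Rmin (d / 2) (d0 / 2)) (Rmin eps (delta / (2 * (norm2 v + 2))))).
    assert (Ht : 0 < t).
    { pose proof (cond_pos d0). repeat apply Rmin_pos; try lra. apply Rdiv_lt_0_compat; lra. }
    assert (Ht1 : t <= d / 2) by (eapply Rle_trans; [apply Rmin_l|apply Rmin_l]).
    assert (Ht2 : t <= d0 / 2) by (eapply Rle_trans; [apply Rmin_l|apply Rmin_r]).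
    assert (Ht3 : t <= eps) by (eapply Rle_trans; [apply Rmin_r|apply Rmin_l]).
    assert (Ht4 : t * (2 * (norm2 v + 2)) <= delta).
    { apply Rle_div_r; [lra|]. eapply Rle_trans; [apply Rmin_r|apply Rmin_r]. }
    set (s := sg * t).
    assert (Hs : Rabs s = t) by (unfold s; rewrite Rabs_mult, Hsg, Rabs_pos_eq; lra).
    specialize (Hf s). change (norm s) with (Rabs s) in Hf. rewrite Hs in Hf.
    specialize (Hf ltac:(lra)).
    set (k := sub2 (gamma s) q).
    set (e := sub2 k (scal2 s v)).
    assert (He' : norm2 e <= 2 * (eps * t)).
    { eapply Rle_trans; [apply norm_C2_R_ge|]. apply Rmult_le_compat_l; [lra|].
      eapply Rle_trans; [|exact Hf]. apply Req_le. f_equal.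
      rewrite H0.
      unfold e, k, sub2, scal2, minus, plus, opp, scal; simpl.
      unfold prod_plus, prod_opp, prod_scal, plus, opp, scal; simpl.
      unfold prod_plus, prod_opp, prod_scal, plus, opp, scal; simpl.
      unfold mult, Cminus, Cplus, Copp, Cmult; simpl.
      rewrite (Rplus_0_l s). f_equal; f_equal; ring. }
    assert (Hek : k = add2 e (scal2 s v)).
    { unfold e, k, add2, sub2, scal2; simpl. f_equal; ring. }
    assert (Hk : norm2 k <= t * (norm2 v + 2)).
    { rewrite Hek.
      assert (Htri : forall a b, norm2 (add2 a b) <= norm2 a + norm2 b).
      { intros a b. unfold norm2, add2; simpl.
        pose proof (Cmod_triangle (fst a) (fst b)).
        pose proof (Cmod_triangle (snd a) (snd b)). lra. }
      eapply Rle_trans; [apply Htri|]. rewrite norm2_scal2, Cmod_R, Hs. nra. }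
    assert (HG : Re (quadratic m1 m2 q11 q12 q22 k) <= 0).
    { apply Hneg.
      - fold k. assert (0 < t * (norm2 v + 2)) by (apply Rmult_lt_0_compat; lra). lra.
      - apply Hd0. change (Rabs (s + - 0) < d0).
        replace (s + - 0) with s by ring. rewrite Hs. pose proof (cond_pos d0). lra. }
    specialize (Hquad k).
    pose proof (re_le_Cmod (quadratic m1 m2 q11 q12 q22 k - pairing (m1, m2) k)%C) as Hre.
    unfold Cminus in Hre, Hquad. rewrite re_plus, re_opp in Hre.
    apply Rabs_le_between in Hre.
    assert (Hpk : Re (pairing (m1, m2) k) = Re (pairing (m1, m2) e) + s * Re (pairing (m1, m2) v)).
    { rewrite Hek. unfold pairing, add2, scal2, Re, Im; simpl. ring. }
    clearbody e.
    assert (Hpe : Rabs (Re (pairing (m1, m2) e)) <= M * norm2 e).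
    { eapply Rle_trans; [apply re_le_Cmod|]. unfold pairing; simpl.
      eapply Rle_trans; [apply Cmod_triangle|]. rewrite !Cmod_mult. unfold M, norm2.
      pose proof (Cmod_ge_0 m1). pose proof (Cmod_ge_0 m2).
      pose proof (Cmod_ge_0 (fst e)). pose proof (Cmod_ge_0 (snd e)). nra. }
    apply Rabs_le_between in Hpe.
    assert (Hk2 : A * norm2 k ^ 2 <= A * (t * (norm2 v + 2)) ^ 2).
    { apply Rmult_le_compat_l; auto. apply pow_incr. split; [apply norm2_ge_0|auto]. }
    assert (HMe : M * norm2 e <= M * (2 * (eps * t))) by (apply Rmult_le_compat_l; auto).
    assert (Htt : A * (t * (norm2 v + 2)) ^ 2 <= t * (eps * (A * (norm2 v + 2) ^ 2))).
    { replace (A * (t * (norm2 v + 2)) ^ 2) with (t * (t * (A * (norm2 v + 2) ^ 2))) by ring.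
      apply Rmult_le_compat_l; [lra|]. apply Rmult_le_compat_r; auto.
      apply Rmult_le_pos; auto. apply pow2_ge_0. }
    apply Rmult_le_reg_l with t; auto. unfold s in Hpk. lra. }
  assert (Hle : forall sg, Rabs sg = 1 -> sg * Re (pairing (m1, m2) v) <= 0).
  { intros sg Hsg. apply Rnot_lt_le; intros Hlt.
    set (B := 2 * M + A * (norm2 v + 2) ^ 2) in Hup.
    assert (HB : 0 <= B).
    { unfold B. assert (0 <= A * (norm2 v + 2) ^ 2); [|lra].
      apply Rmult_le_pos; auto; apply pow2_ge_0. }
    set (X := sg * Re (pairing (m1, m2) v)) in *.
    set (eps := Rmin 1 (X / (2 * (B + 1)))).
    assert (He : 0 < eps) by (apply Rmin_pos; [lra|apply Rdiv_lt_0_compat; lra]).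
    specialize (Hup eps He (Rmin_l _ _) sg Hsg). fold X in Hup.
    pose proof (Rmin_r 1 (X / (2 * (B + 1)))) as Hr. fold eps in Hr.
    apply Rle_div_r in Hr; [|lra]. nra. }
  pose proof (Hle 1 Rabs_R1).
  assert (A2 : Rabs (-1) = 1) by (rewrite Rabs_left; lra).
  pose proof (Hle (-1) A2). lra. }
pose proof (Key _ Hiv) as K2.
assert (K3 : Im (pairing (m1, m2) v) = 0).
{ replace (pairing (m1, m2) (scal2 Ci v)) with (pairing (m1, m2) v * Ci)%C in K2
    by (unfold pairing, scal2; simpl; ring).
  rewrite re_mult_Ci in K2. lra. }
rewrite (real_complex _ K3). f_equal. apply Key, Hv.
Qed.

(** A peak polynomial at q = f (c + v), pulled back to a disc z -> f (c + z v)
    with values in the closure of D. *)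
Lemma peak_on_disc (D : C2 -> Prop) (f : C2 -> C2) (c v q : C2)
    (m1 m2 q11 q12 q22 : C) (eps d : R) (L : C2 -> C2) :
  0 < eps -> 0 < d ->
  (forall h, norm2 h < d -> closure D (add2 q h) ->
     Re (quadratic m1 m2 q11 q12 q22 h) <= - eps * norm2 h ^ 2) ->
  (forall z, Cmod z <= 1 -> closure D (f (line c v z))) ->
  (forall z, Cmod z <= 1 ->
     ex_filterdiff (K := C_AbsRing) (V := prod_NormedModule C_AbsRing C_NormedModule C_NormedModule)
       f (locally (line c v z))) ->
  f (line c v 1) = q ->
  filterdiff (K := C_AbsRing) f (locally (line c v 1)) L ->
  let G := fun z => quadratic m1 m2 q11 q12 q22 (sub2 (f (line c v z)) q) in
  (forall z, Cmod z <= 1 -> exists l, cdiff G z l) /\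
  cdiff G 1 (pairing (m1, m2) (L v)) /\ G 1 = 0 /\
  exists delta, 0 < delta /\ forall z, Cmod z <= 1 -> Cmod (z - 1)%C < delta ->
    Re (G z) <= - eps * norm2 (sub2 (f (line c v z)) q) ^ 2.
Proof.
intros He Hd Hpeak Hcl Hdiff Hq HL G.
assert (HG1 : G 1 = 0).
{ unfold G. rewrite Hq. unfold quadratic, sub2; simpl. ring. }
repeat split; auto.
- intros z Hz. destruct (Hdiff z Hz) as [L' HL'].
  destruct (cdiff_quadratic_line m1 m2 q11 q12 q22 f c v z q L' HL') as (l & Hl & _).
  exists l; exact Hl.
- destruct (cdiff_quadratic_line m1 m2 q11 q12 q22 f c v 1 q L HL) as (l & Hl & El).
  rewrite <- (El Hq). exact Hl.
- destruct (cdiff_line_components f c v 1 L HL) as [H1 H2].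
  destruct (cdiff_lipschitz _ _ _ H1) as (d1 & Hd1 & HH1).
  destruct (cdiff_lipschitz _ _ _ H2) as (d2 & Hd2 & HH2).
  pose proof (Cmod_ge_0 (fst (L v))). pose proof (Cmod_ge_0 (snd (L v))).
  set (A := Cmod (fst (L v)) + 1 + (Cmod (snd (L v)) + 1)).
  assert (HA : 0 < A) by (unfold A; lra).
  exists (Rmin (Rmin d1 d2) (d / A)). split.
  { apply Rmin_pos; [apply Rmin_pos; auto|apply Rdiv_lt_0_compat; auto]. }
  intros z Hz Hz1.
  pose proof (Rmin_l (Rmin d1 d2) (d / A)). pose proof (Rmin_r (Rmin d1 d2) (d / A)).
  pose proof (Rmin_l d1 d2). pose proof (Rmin_r d1 d2).
  specialize (HH1 (z - 1)%C ltac:(lra)). specialize (HH2 (z - 1)%C ltac:(lra)).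
  replace (1 + (z - 1))%C with z in HH1, HH2 by ring.
  rewrite Hq in HH1, HH2.
  assert (HzA : Cmod (z - 1)%C * A < d) by (apply Rlt_div_r; lra).
  apply Hpeak.
  + unfold norm2, sub2; simpl. unfold A in HzA. lra.
  + rewrite add2_sub2. auto.
Qed.

(** * Holomorphic functions on the bidisc *)

(** Maximum principle on the bidisc, with the torus as boundary: first for
    |w| = 1 in the variable z, then for fixed z in the variable w. *)
Lemma bidisc_maximum (f : C2 -> C) :
  holomorphic (E := C_NormedModule) closed_bidisc f ->
  (forall p, torus p -> Re (f p) <= 0) ->
  forall p, closed_bidisc p -> Re (f p) <= 0.
Proof.
intros Hf Ht.
assert (Hz : forall p v, (forall z, Cmod z <= 1 -> closed_bidisc (line p v z)) ->
  (forall z, Cmod z = 1 -> Re (f (line p v z)) <= 0) ->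
  forall z, Cmod z <= 1 -> Re (f (line p v z)) <= 0).
{ intros p v Hc Hb. apply disc_maximum; auto.
  intros z Hz. destruct (Hf _ (Hc z Hz)) as [L HL]. eexists. apply cdiff_line, HL. }
assert (H1 : forall z w : C, Cmod z <= 1 -> Cmod w = 1 -> Re (f (z, w)) <= 0).
{ intros z w Hzz Hw. rewrite <- line_e1. apply Hz; auto.
  - intros z' Hz'. rewrite line_e1. split; simpl; lra.
  - intros z' Hz'. rewrite line_e1. apply Ht. split; simpl; auto. }
intros [z w] [Hzz Hw]. simpl in Hzz, Hw. rewrite <- line_e2. apply Hz; auto.
- intros w' Hw'. rewrite line_e2. split; simpl; lra.
- intros w' Hw'. rewrite line_e2. apply H1; auto.
Qed.

(** A holomorphic function on the closed bidisc that is real and nonnegative on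
    the torus, and nonzero at the origin, is a positive constant on the bidisc. *)
Lemma torus_positive_constant (f : C2 -> C) :
  holomorphic (E := C_NormedModule) closed_bidisc f ->
  (forall p, torus p -> Im (f p) = 0 /\ 0 <= Re (f p)) ->
  f origin <> 0 ->
  exists k : R, 0 < k /\ forall p, bidisc p -> f p = k.
Proof.
intros Hf Ht Hf0.
assert (HC : forall (c : C), holomorphic (E := C_NormedModule) closed_bidisc
  (fun p => c * f p)%C).
{ intros c p Hp. apply ex_filterdiff_Cmult; [apply ex_filterdiff_const|apply Hf, Hp]. }
assert (HI : forall p, closed_bidisc p -> Im (f p) = 0).
{ intros p Hp.
  pose proof (bidisc_maximum _ (HC Ci)) as H1.
  pose proof (bidisc_maximum _ (HC (- Ci)%C)) as H2.
  assert (A : Re (Ci * f p)%C <= 0).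
  { apply H1; auto. intros q Hq. destruct (Ht q Hq) as [Hi _]. rewrite re_mult, Hi.
    simpl; lra. }
  assert (B : Re (- Ci * f p)%C <= 0).
  { apply H2; auto. intros q Hq. destruct (Ht q Hq) as [Hi _]. rewrite re_mult, Hi.
    simpl; lra. }
  rewrite re_mult in A, B. simpl in A, B. lra. }
assert (O : closed_bidisc origin) by (split; simpl; rewrite Cmod_0; lra).
assert (HR : 0 <= Re (f origin)).
{ assert (A : Re ((- (1)) * f origin)%C <= 0).
  { apply (bidisc_maximum _ (HC (- (1))%C)); auto.
    intros q Hq. destruct (Ht q Hq) as [Hi Hr]. rewrite re_mult, Hi. simpl; lra. }
  rewrite re_mult in A. simpl in A. lra. }
exists (Re (f origin)). split.
{ destruct HR as [HR|HR]; auto. exfalso. apply Hf0.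
  rewrite (real_complex _ (HI _ O)), <- HR. reflexivity. }
assert (Hz : forall p v, (forall z, Cmod z < 1 -> closed_bidisc (line p v z)) ->
  forall z, Cmod z < 1 -> f (line p v z) = f (line p v 0)).
{ intros p v Hc. apply (real_valued_constant (fun z => f (line p v z))).
  - intros z Hz. destruct (Hf _ (Hc z Hz)) as [L HL]. eexists. apply cdiff_line, HL.
  - intros z Hz. apply HI; auto. }
intros [z w] [H1 H2]. simpl in H1, H2.
rewrite <- (real_complex _ (HI _ O)).
transitivity (f (RtoC 0, w)).
- assert (E : f (line (RtoC 0, w) e1 z) = f (line (RtoC 0, w) e1 0)).
  { apply Hz; auto. intros z' Hz'. rewrite line_e1. split; simpl; lra. }
  rewrite !line_e1 in E. exact E.
- assert (E : f (line (RtoC 0, RtoC 0) e2 w) = f (line (RtoC 0, RtoC 0) e2 0)).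
  { apply Hz; auto. intros w' Hw'. rewrite line_e2. split; simpl; rewrite ?Cmod_0; lra. }
  rewrite !line_e2 in E. exact E.
Qed.

(** * The ratio of the coefficients on the torus *)

(** The discs z -> (p - v) + z v used below: the diagonal disc through p and
    the two discs in the coordinate directions. *)
Lemma torus_disc (p : C2) : torus p ->
  (forall v, v = p \/ v = (fst p, RtoC 0) \/ v = (RtoC 0, snd p) ->
    line (sub2 p v) v 1 = p /\ forall z, Cmod z <= 1 -> closed_bidisc (line (sub2 p v) v z)).
Proof.
intros [H1 H2] v Hv.
split.
- unfold line, add2, sub2, scal2; simpl. rewrite (surjective_pairing p) at 3. f_equal; ring.
- intros z Hz. unfold line, add2, sub2, scal2, closed_bidisc; simpl.
  destruct Hv as [-> | [-> | ->]]; simpl.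
  + replace (fst p - fst p + z * fst p)%C with (z * fst p)%C by ring.
    replace (snd p - snd p + z * snd p)%C with (z * snd p)%C by ring.
    rewrite !Cmod_mult, H1, H2. lra.
  + replace (fst p - fst p + z * fst p)%C with (z * fst p)%C by ring.
    replace (snd p - 0 + z * 0)%C with (snd p) by ring.
    rewrite Cmod_mult, H1, H2. lra.
  + replace (fst p - 0 + z * 0)%C with (fst p) by ring.
    replace (snd p - snd p + z * snd p)%C with (z * snd p)%C by ring.
    rewrite Cmod_mult, H1, H2. lra.
Qed.

(** Here l1 and l2 are the derivatives at 1 of the peak function along the
    coordinate discs through p, and (b z, - a w) is the direction of G at p. *)
Lemma torus_ratio (D : C2 -> Prop) (Phi Phi_inv : C2 -> C2) (F G : foliation) (a b : C2 -> C)
    (p : C2) :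
  strictly_pseudoconvex_boundary D ->
  (forall x, bidisc x -> Phi_inv (Phi x) = x) ->
  (forall x, closed_bidisc x -> closure D (Phi x)) ->
  (forall x, torus x -> boundary D (Phi x)) ->
  complex_tangency_set F (boundary D) (Phi p) ->
  (forall x, closed_bidisc x -> fdom G x) ->
  is_pullback Phi F G ->
  (forall x, fdom G x -> a x <> RtoC 0) -> (forall x, fdom G x -> b x <> RtoC 0) ->
  defined_by G (fun x => (Cmult (a x) (snd x), Cmult (b x) (fst x))) ->
  torus p ->
  Im (a p / b p)%C = 0 /\ 0 <= Re (a p / b p)%C.
Proof.
intros Hspsc Hinv Hcl Hbd (_ & Hreg & Htan) HG (HPhi & _ & Hpull) Ha Hb [_ Hdef] Hp.
assert (Hpc : closed_bidisc p) by (destruct Hp; split; lra).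
set (q := Phi p).
(* L is the differential of Phi at p; it maps the direction of G into that of F. *)
assert (HLx : exists i L h eta (g : C), fchart F i q /\
   filterdiff (K := C_AbsRing) Phi (locally p) L /\
   (forall v, pairing (fform F i q) (L v) = Cmult h (pairing eta v)) /\
   g <> RtoC 0 /\ (Cmult (a p) (snd p), Cmult (b p) (fst p)) = scal2 g eta).
{ destruct Hreg as (i & Hi & _).
  destruct (proj1 (fdom_cover G p) (HG p Hpc)) as [j Hj].
  destruct (Hpull i j p Hj Hi) as (W & h & _ & HWp & _ & _ & HW).
  destruct (HW p HWp) as (_ & _ & L & HL & HLp).
  destruct (Hdef j) as (g & _ & Hg). destruct (Hg p Hj) as [Hg0 Hg1].
  exists i, L, (h p), (fform G j p), (g p). auto. }
destruct HLx as (i & L & h & eta & g & Hi & HL & Hpair & Hg0 & Hg1).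
destruct (filterdiff_linear_C2 _ _ _ HL) as [Hadd Hscal].
destruct (levi_polynomial D q Hspsc (Hbd p Hp))
  as (m1 & m2 & q11 & q12 & q22 & eps & d & He & Hd & Hpeak).
assert (Hdisc : forall v, v = p \/ v = (fst p, RtoC 0) \/ v = (RtoC 0, snd p) ->
  let c := sub2 p v in
  let g := fun z => quadratic m1 m2 q11 q12 q22 (sub2 (Phi (line c v z)) q) in
  (forall z, Cmod z <= 1 -> exists l, cdiff g z l) /\
  cdiff g 1 (pairing (m1, m2) (L v)) /\ g 1 = 0 /\
  exists delta, 0 < delta /\ forall z, Cmod z <= 1 -> Cmod (z - 1)%C < delta ->
    Re (g z) <= - eps * norm2 (sub2 (Phi (line c v z)) q) ^ 2).
{ intros v Hv c. destruct (torus_disc p Hp v Hv) as [E1 Hin].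
  apply (peak_on_disc D Phi c v q m1 m2 q11 q12 q22 eps d L); auto.
  - unfold c. rewrite E1. reflexivity.
  - unfold c. rewrite E1. exact HL. }
set (l1 := pairing (m1, m2) (L (fst p, RtoC 0))).
set (l2 := pairing (m1, m2) (L (RtoC 0, snd p))).
assert (Hnn : forall v, v = p \/ v = (fst p, RtoC 0) \/ v = (RtoC 0, snd p) ->
  Im (pairing (m1, m2) (L v)) = 0 /\ 0 <= Re (pairing (m1, m2) (L v))).
{ intros v Hv. destruct (Hdisc v Hv) as (_ & D1 & D2 & delta & Hdelta & Hneg).
  apply (boundary_maximum_derivative _ delta _ Hdelta D1 D2).
  intros z Hz Hz1. specialize (Hneg z Hz Hz1).
  match type of Hneg with _ <= - eps * ?X ^ 2 => pose proof (pow2_ge_0 X) end. nra. }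
destruct (Hnn _ (or_intror (or_introl eq_refl))) as [I1 R1]. fold l1 in I1, R1.
destruct (Hnn _ (or_intror (or_intror eq_refl))) as [I2 R2]. fold l2 in I2, R2.
assert (Hsum : pairing (m1, m2) (L p) = (l1 + l2)%C).
{ unfold l1, l2. replace p with (add2 (fst p, RtoC 0) (RtoC 0, snd p)) at 1.
  - rewrite Hadd. unfold pairing, add2; simpl. ring.
  - unfold add2; simpl. rewrite (surjective_pairing p) at 3. f_equal; ring. }
assert (Hpos : 0 < Re l1 + Re l2).
{ rewrite <- re_plus, <- Hsum.
  destruct (Hdisc p (or_introl eq_refl)) as (D0 & D1 & D2 & delta & Hdelta & Hneg).
  set (c := sub2 p p) in *.
  assert (Hline : forall z, line c p z = scal2 z p).
  { intros z. unfold line, add2, c, sub2, scal2; simpl. f_equal; ring. }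
  destruct Hp as [Hp1 Hp2].
  assert (Hinb : forall z, Cmod z < 1 -> bidisc (line c p z)).
  { intros z Hz. rewrite Hline. unfold bidisc, scal2; simpl.
    rewrite !Cmod_mult, Hp1, Hp2. lra. }
  assert (Hinj : forall z z', Cmod z < 1 -> Cmod z' < 1 ->
    Phi (line c p z) = q -> Phi (line c p z') = q -> z = z').
  { intros z z' Hz Hz' E E'.
    assert (E2 : line c p z = line c p z').
    { rewrite <- (Hinv _ (Hinb z Hz)), <- (Hinv _ (Hinb z' Hz')). congruence. }
    rewrite !Hline in E2. apply (f_equal fst) in E2. simpl in E2.
    assert (Hp0 : fst p <> 0) by (intros Z; rewrite Z, Cmod_0 in Hp1; lra).
    transitivity (z * fst p / fst p)%C; [field; auto|]. rewrite E2. field; auto. }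
  (* By injectivity Phi takes the value q at most once inside the disc, hence not near 1. *)
  assert (Hd1 : exists d1, 0 < d1 /\ forall z, Cmod z < 1 -> Cmod (z - 1)%C < d1 ->
    Phi (line c p z) <> q).
  { destruct (classic (exists z, Cmod z < 1 /\ Phi (line c p z) = q)) as [(z0 & Hz0 & E0)|Hno].
    - exists (Cmod (z0 - 1)%C). split.
      + apply Cmod_gt_0. intros Z. replace z0 with (z0 - 1 + 1)%C in Hz0 by ring.
        rewrite Z, Cplus_0_l, Cmod_1 in Hz0. lra.
      + intros z Hz Hz1 E. rewrite (Hinj z z0 Hz Hz0 E E0) in Hz1. lra.
    - exists 1. split; [lra|]. intros z Hz _ E. apply Hno. exists z; auto. }
  destruct Hd1 as (d1 & Hd1 & Hne).
  apply (hopf_boundary _ (Rmin delta d1) _ (Rmin_pos _ _ Hdelta Hd1)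
    (fun z Hz _ => D0 z Hz) D2 D1).
  { intros z Hz Hz1.
    pose proof (Rmin_l delta d1). pose proof (Rmin_r delta d1).
    specialize (Hneg z ltac:(lra) ltac:(lra)).
    specialize (Hne z Hz ltac:(lra)).
    eapply Rle_lt_trans; [exact Hneg|].
    assert (0 < norm2 (sub2 (Phi (line c p z)) q)).
    { destruct (norm2_ge_0 (sub2 (Phi (line c p z)) q)) as [Hl|Hl]; auto.
      exfalso. apply Hne. rewrite <- (add2_sub2 q (Phi (line c p z))).
      set (k := sub2 (Phi (line c p z)) q) in *. unfold norm2 in Hl.
      pose proof (Cmod_ge_0 (fst k)). pose proof (Cmod_ge_0 (snd k)).
      assert (E1 : fst k = 0) by (apply Cmod_eq_0; lra).
      assert (E2 : snd k = 0) by (apply Cmod_eq_0; lra).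
      unfold add2. rewrite E1, E2, !Cplus_0_r. symmetry; apply surjective_pairing. }
    assert (0 < norm2 (sub2 (Phi (line c p z)) q) ^ 2) by (apply pow_lt; auto). nra. } }
assert (Htang : (b p * l1 = a p * l2)%C).
{ set (v := add2 (scal2 (b p) (fst p, RtoC 0)) (scal2 (- a p)%C (RtoC 0, snd p))).
  assert (Hv : pairing (m1, m2) (L v) = 0).
  { apply (quadratic_complex_tangent m1 m2 q11 q12 q22 (boundary D) q (L v) d Hd).
    - intros x Hx [Hx1 _]. pose proof (Hpeak (sub2 x q) Hx) as Hk.
      rewrite add2_sub2 in Hk. specialize (Hk Hx1).
      pose proof (pow2_ge_0 (norm2 (sub2 x q))). nra.
    - apply Htan. exists i. split; auto. rewrite Hpair.
      assert (Hz : (g * pairing eta v = 0)%C).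
      { transitivity (pairing (scal2 g eta) v).
        - unfold pairing, scal2; simpl. ring.
        - rewrite <- Hg1. unfold pairing, v, add2, scal2; simpl. ring. }
      destruct (Ceq_dec (pairing eta v) 0) as [Hz0|Hz0].
      + rewrite Hz0. ring.
      + exfalso. apply (Cmult_neq_0 g (pairing eta v)); auto. }
  unfold v in Hv. rewrite Hadd, !Hscal in Hv.
  assert (E : pairing (m1, m2) (add2 (scal2 (b p) (L (fst p, RtoC 0)))
     (scal2 (- a p)%C (L (RtoC 0, snd p)))) = (b p * l1 - a p * l2)%C).
  { unfold l1, l2, pairing, add2, scal2; simpl. ring. }
  rewrite E in Hv. transitivity (b p * l1 - a p * l2 + a p * l2)%C; [ring|].
  rewrite Hv. ring. }
pose proof (Ha p (HG p Hpc)) as Ha0. pose proof (Hb p (HG p Hpc)) as Hb0.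
rewrite (real_complex l1 I1), (real_complex l2 I2) in Htang.
destruct R2 as [R2|R2].
- assert (Hl2 : RtoC (Re l2) <> 0) by (intros Z; apply RtoC_inj in Z; lra).
  assert (E : (a p / b p)%C = RtoC (Re l1 / Re l2)).
  { rewrite RtoC_div by lra.
    transitivity (a p * Re l2 / (b p * Re l2))%C; [field; auto|].
    rewrite <- Htang. field; auto. }
  rewrite E. split; [reflexivity|]. simpl.
  apply Rmult_le_pos; auto. apply Rlt_le, Rinv_0_lt_compat; auto.
- exfalso. rewrite <- R2, Cmult_0_r in Htang.
  apply (Cmult_neq_0 (b p) (RtoC (Re l1))); auto.
  intros Z. apply RtoC_inj in Z. lra.
Qed.

(** * Linearization *)

(** The coefficients of z dw - tau w dz. *)
Definition linear_form (tau : R) (q : C2) : C2 :=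
  (Copp (Cmult (RtoC tau) (snd q)), fst q).

Lemma linear_form_holomorphic (tau : R) (A : C2 -> Prop) :
  holomorphic (E := prod_NormedModule C_AbsRing C_NormedModule C_NormedModule) A
    (linear_form tau).
Proof.
intros p _.
assert (H1 : ex_filterdiff (K := C_AbsRing) (V := C_NormedModule)
  (fun q : C2 => Copp (Cmult (RtoC tau) (snd q))) (locally p)).
{ apply (ex_filterdiff_ext (fun q : C2 => (- tau)%C * snd q)%C).
  - intros q. change ((- tau)%C * snd q = - (tau * snd q) :> C)%C. ring.
  - apply ex_filterdiff_Cmult; [apply ex_filterdiff_const|].
    apply (ex_filterdiff_linear snd), is_linear_snd. }
assert (H2 : ex_filterdiff (K := C_AbsRing) (V := C_NormedModule)
  (fun q : C2 => fst q) (locally p)).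
{ apply (ex_filterdiff_linear fst), is_linear_fst. }
apply (ex_filterdiff_comp'_2 _ _ (fun x y : C => (x, y)) p H1 H2).
apply (ex_filterdiff_ext (fun t => t)).
- intros t. apply surjective_pairing.
- apply ex_filterdiff_id.
Qed.

Lemma linear_form_zero (tau : R) (q : C2) :
  tau < 0 -> linear_form tau q = origin -> q = origin.
Proof.
intros Ht E.
pose proof (f_equal fst E) as E1. pose proof (f_equal snd E) as E2. simpl in E1, E2.
assert (Ht0 : RtoC tau <> 0) by (intros Z; apply RtoC_inj in Z; lra).
rewrite (surjective_pairing q), E2. unfold origin. f_equal.
transitivity (- (- (tau * snd q)) / tau)%C; [field; auto|].
rewrite E1. field; auto.
Qed.

(** The foliation z dw - tau w dz = 0 of the bidisc. *)
Definition linear_foliation (tau : R) (Htau : tau < 0) (Hopen : open bidisc) : foliation.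
Proof.
(* A single chart; the only zero of the form is the origin. *)
refine (Build_foliation bidisc unit (fun _ => bidisc) (fun _ => linear_form tau)
  (fun _ => Hopen) _ (fun _ => linear_form_holomorphic tau bidisc) _ _).
- intros p. split; [intros Hp; exists tt; exact Hp|intros [_ Hp]; exact Hp].
- intros _ p _ Hp. exists (fun _ => True). split; [apply open_true|]. split; [exact I|].
  intros q _ _ Hq.
  rewrite (linear_form_zero tau p Htau Hp), (linear_form_zero tau q Htau Hq). reflexivity.
- intros _ _. exists (fun _ => RtoC 1). split.
  + intros p _. apply ex_filterdiff_const.
  + intros p _ _. split.
    * intros Z. apply RtoC_inj in Z. lra.
    * unfold scal2. rewrite !Cmult_1_l. apply surjective_pairing.
Defined.

Theorem theorem4
  (D : C2 -> Prop) (Phi : C2 -> C2) (V : C2 -> Prop)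
  (F G : foliation) (a b : C2 -> C)
  (D_domain : domain D)
  (D_bounded : bounded D)
  (D_spsc : strictly_pseudoconvex_boundary D)
  (V_open : open V)
  (V_nbhd : forall p, closed_bidisc p -> V p)
  (Phi_extends : holomorphic V Phi)
  (Phi_embedding : exists Phi_inv : C2 -> C2,
      biholomorphism bidisc (image Phi bidisc) Phi Phi_inv)
  (Phi_0 : Phi origin = origin)
  (Phi_closure : forall p, closed_bidisc p -> closure D (Phi p))
  (Phi_torus : forall p, torus p -> boundary D (Phi p))
  (F_nbhd : forall p, closed_bidisc p -> fdom F (Phi p))
  (F_tangent : forall p, torus p ->
      complex_tangency_set F (boundary D) (Phi p))
  (G_nbhd : forall p, closed_bidisc p -> fdom G p)
  (G_pullback : is_pullback Phi F G)
  (a_holo : holomorphic (fdom G) a)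
  (a_unit : forall p, fdom G p -> a p <> RtoC 0)
  (b_holo : holomorphic (fdom G) b)
  (b_unit : forall p, fdom G p -> b p <> RtoC 0)
  (G_defined : defined_by G
      (fun p => (Cmult (a p) (snd p), Cmult (b p) (fst p)))) :
  linearizable_of_siegel_type F.
Proof.
destruct Phi_embedding as (Phi_inv & Hbi_open & Him_open & HPhi & HPhi_inv & Hb1 & Hb2).
assert (Hbc : forall p, bidisc p -> closed_bidisc p) by (intros p [H1 H2]; split; lra).
assert (HbG : forall p, bidisc p -> fdom G p) by auto.
assert (HO : bidisc origin) by (split; simpl; rewrite Cmod_0; lra).
destruct (torus_positive_constant (fun p => a p / b p)%C) as (k & Hk & Hconst).
- intros p Hp. apply ex_filterdiff_Cdiv; auto.
- intros p Hp. apply (torus_ratio D Phi Phi_inv F G a b p); auto.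
  intros x Hx. apply Hb1, Hx.
- intros Z. apply (a_unit origin (HbG _ HO)).
  transitivity (a origin / b origin * b origin)%C; [field; auto|]. rewrite Z. ring.
- assert (Hab : forall p, bidisc p -> a p = (k * b p)%C).
  { intros p Hp. rewrite <- (Hconst p Hp). field. auto. }
  assert (Htau : - k < 0) by lra.
  exists (image Phi bidisc), Phi_inv, Phi, (linear_foliation (- k) Htau Hbi_open), (- k).
  split; [exists origin; auto|].
  split; [intros q (p & Hp & <-); auto|].
  split; [repeat split; auto; try apply Hb1; try apply Hb2; auto|].
  split; [rewrite <- Phi_0 at 1; apply Hb1, HO|].
  split; [|split; [exact Htau|]].
  + split; [exact HPhi|]. split; [intros q Hq; auto|].
    destruct G_pullback as (_ & _ & Hpull). destruct G_defined as [_ Hdef].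
    intros i j q Hq Hi. simpl in Hq.
    destruct (proj1 (fdom_cover G q) (HbG q Hq)) as [jG HjG].
    destruct (Hpull i jG q HjG Hi) as (W & h & HWo & HWq & Hh & Hhnz & HW).
    destruct (Hdef jG) as (g & Hg & Hgeq).
    (* With a = k b, the form of the linear foliation is g / b times the form of G. *)
    exists (fun x => W x /\ bidisc x), (fun x => h x * (b x / g x))%C.
    split; [apply open_and; auto|]. split; [auto|]. split; [|split].
    * intros x [HxW Hxb]. destruct (HW x HxW) as (HxG & _).
      destruct (Hgeq x HxG) as [Hgx _].
      apply ex_filterdiff_Cmult; [apply Hh, HxW|].
      apply ex_filterdiff_Cdiv; auto.
    * intros W' HW'o HW'x HW'W.
      destruct (Hhnz W' HW'o HW'x) as (x & HxW' & Hhx); [intros x Hx; apply HW'W, Hx|].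
      exists x. split; auto.
      destruct (HW'W x HxW') as [HxW Hxb]. destruct (HW x HxW) as (HxG & _).
      destruct (Hgeq x HxG) as [Hgx _].
      apply Cmult_neq_0; auto. apply Cmult_neq_0; auto.
      intros Z.
      assert (E : (g x * / g x)%C = 1) by (field; auto).
      rewrite Z, Cmult_0_r in E. apply RtoC_inj in E. lra.
    * intros x [HxW Hxb]. destruct (HW x HxW) as (HxG & HxF & L & HL & Heq).
      destruct (Hgeq x HxG) as [Hgx Heta].
      split; [exact Hxb|]. split; [exact HxF|].
      exists L. split; [exact HL|]. intros v. rewrite Heq.
      rewrite (Hab x Hxb) in Heta.
      assert (E : (g x * pairing (fform G jG x) v = b x * pairing (linear_form (- k) x) v)%C).
      { transitivity (pairing (scal2 (g x) (fform G jG x)) v).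
        - unfold pairing, scal2; simpl. ring.
        - rewrite <- Heta. unfold pairing, linear_form; simpl. rewrite RtoC_opp. ring. }
      change (fform (linear_foliation (- k) Htau Hbi_open) j x) with (linear_form (- k) x).
      transitivity (h x * (g x * pairing (fform G jG x) v) / g x)%C; [field; auto|].
      rewrite E. field; auto.
  + split.
    * apply linear_form_holomorphic.
    * intros i. exists (fun _ => RtoC 1). split.
      -- intros p _. apply ex_filterdiff_const.
      -- intros p _. split.
         ++ intros Z. apply RtoC_inj in Z. lra.
         ++ unfold scal2. rewrite !Cmult_1_l. apply surjective_pairing.
Qed.
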